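(* Let $\Phi$ be a finite NCIFS on $X\subset\mathbb R^d$. For $n\ge1$ put \[\underline c_n:=\min_{a\in I^{(n)}}\|D\phi^{(n)}_a\|,\qquad \rho_n:=\max_{a,b\in I^{(n)}}\frac{\|D\phi^{(n)}_a\|}{\|D\phi^{(n)}_b\|},\qquad \tilde Z_n(t):=Z_{n-1}(t)\,(\# I^{(n)})^{t/d}\,\underline c_n^{\,t}.\] If $t\ge0$ satisfies \[\liminf_{n\to\infty}\frac{\tilde Z_n(t)}{1+\log\max_{j\le n}\rho_j}>0,\] then $\operatorname{HD}(J(\Phi))\ge t$.
   Context: Fix $d\in\mathbb N$ and a compact set $X\subset\mathbb R^d$ equal to the closure of its interior, such that $\partial X$ is smooth or $X$ is convex. For a conformal map $\phi$, $\|D\phi\|:=\sup_{x\in X}|\phi'(x)|$, where $|\phi'(x)|$ is the scaling factor of $D\phi(x)$. An NCIFS $\Phi$ on $X$ is a sequence $\Phi^{(1)},\Phi^{(2)},\dots$ with $\Phi^{(j)}=(\phi^{(j)}_i:X\to X)_{i\in I^{(j)}}$, where each $I^{(j)}$ is a finite or countably infinite index set, such that: - (open set condition) $\phi^{(j)}_a(\operatorname{int}X)\cap\phi^{(j)}_b(\operatorname{int}X)=\emptyset$ for all $j$ and distinct $a,b\in I^{(j)}$; - (conformality) there is an open connected $V\supset X$ such that every $\phi^{(j)}_i$ extends to a $C^1$ conformal diffeomorphism of $V$ into $V$; - (bounded distortion) there is $K\ge1$ such that for all $k\le l$ and all $\omega_j\in I^{(j)}$, $\phi=\phi^{(k)}_{\omega_k}\circ\cdots\circ\phi^{(l)}_{\omega_l}$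 satisfies $|\phi'(x)|\le K|\phi'(y)|$ for $x,y\in V$; - (uniform contraction) there is $\eta<1$ with $\|D\phi^{(j)}_i\|\le\eta$ for all $j,i$. $\Phi$ is finite if every $I^{(j)}$ is finite. Write $I^n=\prod_{j=1}^nI^{(j)}$ and $\phi_\omega=\phi^{(1)}_{\omega_1}\circ\cdots\circ\phi^{(n)}_{\omega_n}$ for $\omega\in I^n$. The limit set is $J(\Phi)=\bigcap_{n}\bigcup_{\omega\in I^n}\phi_\omega(X)$. $Z_n(t)=\sum_{\omega\in I^n}\|D\phi_\omega\|^t$, with $Z_0(t)=1$. $\operatorname{HD}$ is Hausdorff dimension. *)

(* Defs.v *)
From HB Require Import structures.
From mathcomp Require Import all_boot all_order all_algebra.
From mathcomp Require Import all_classical all_reals all_analysis.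
Set Implicit Arguments. Unset Strict Implicit. Unset Printing Implicit Defensive.
Import Order.TTheory GRing.Theory Num.Theory.
Import numFieldNormedType.Exports.
Local Open Scope classical_set_scope.
Local Open Scope ring_scope.

Section NCIFS.
Variables (R : realType) (d : nat).
Local Notation V := 'rV[R]_d.

(* Euclidean norm on R^d (the library norm on row vectors is the max-norm). *)
Definition eucl_norm (v : V) : R := Num.sqrt (\sum_(i < d) v ord0 i ^+ 2).

(* |f'(x)| : scaling factor of Df(x) = operator norm of Df(x) for the
   Euclidean norm (for a conformal linear map this is its scaling factor). *)
Definition scalef (f : V -> V) (x : V) : R :=
  sup [set eucl_norm ('d f x v) | v in [set v : V | eucl_norm v = 1]].

Definition normD (X : set V) (f : V -> V) : R := sup [set scalef f x | x in X].

(* f is C^1 on the open set U (differentiable, with continuous partial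
   derivatives y |-> Df(y) v), injective on U, maps U into U, and Df(x) is a
   conformal linear map (a positive multiple of a Euclidean isometry) at
   every point of U: a C^1 conformal diffeomorphism of U into U. *)
Definition conformal_diffeo_into (U : set V) (f : V -> V) : Prop :=
  [/\ forall x, U x -> differentiable f x,
      forall (v : V) x, U x -> {for x, continuous (fun y => 'd f y v)},
      forall x y, U x -> U y -> f x = f y -> x = y,
      forall x, U x -> U (f x) &
      forall x, U x -> exists2 lam : R, 0 < lam &
        forall v : V, eucl_norm ('d f x v) = lam * eucl_norm v].

Definition convex_set (X : set V) : Prop :=
  forall x y (s : R), X x -> X y -> 0 <= s <= 1 -> X (s *: x + (1 - s) *: y).

Definition iterD (vs : seq V) (g : V -> R) : V -> R :=
  foldr (fun v h => fun x => derive h x v) g vs.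

Definition smooth_on (U : set V) (g : V -> R) : Prop :=
  forall (vs : seq V) x, U x ->
    {for x, continuous (iterD vs g)} /\ forall v : V, derivable (iterD vs g) x v.

Definition smooth_boundary (X : set V) : Prop :=
  forall x, closure X x -> ~ interior X x ->
    exists U : set V, exists g : V -> R,
      [/\ open U, U x, smooth_on U g, exists v : V, derive g x v != 0 &
          X `&` U = [set y | U y /\ g y <= 0]].

Definition good_domain (X : set V) : Prop :=
  [/\ compact X, closure (interior X) = X & (convex_set X \/ smooth_boundary X)].

(* An NCIFS with finite nonempty alphabets I^(j) = 'I_(N j), j >= 1.
   phi j a is phi^(j)_a; the value at j = 0 is unused. *)
Variables (N : nat -> nat) (phi : forall j : nat, 'I_(N j) -> V -> V).

Definition compw (k m : nat) (w : {dffun forall j : 'I_m, 'I_(N (k + j))}) : V -> V :=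
  foldr (fun (j : 'I_m) f => phi (w j) \o f) id (enum 'I_m).

Definition phiw (n : nat) (w : {dffun forall j : 'I_n, 'I_(N (1 + j))}) : V -> V :=
  compw w.

Definition is_finite_NCIFS (X : set V) : Prop :=
  [/\ forall j, (0 < j)%N -> (0 < N j)%N,
      forall j (a b : 'I_(N j)), (0 < j)%N -> a != b ->
        phi a @` interior X `&` phi b @` interior X = set0,
      forall j (a : 'I_(N j)), (0 < j)%N -> phi a @` X `<=` X,
      exists U : set V, [/\ open U, connected U, X `<=` U &
        forall j (a : 'I_(N j)), (0 < j)%N -> conformal_diffeo_into U (phi a)]
        /\
      (exists2 K : R, 1 <= K &
        forall k m (w : {dffun forall j : 'I_m, 'I_(N (k + j))}) x y,
          (0 < k)%N -> (0 < m)%N -> U x -> U y ->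
          scalef (compw w) x <= K * scalef (compw w) y) &
      exists2 eta : R, eta < 1 &
        forall j (a : 'I_(N j)), (0 < j)%N -> normD X (phi a) <= eta].

Definition limit_set (X : set V) : set V :=
  \bigcap_(n in [set: nat]) \bigcup_(w in [set: {dffun forall j : 'I_n, 'I_(N (1 + j))}])
     (phiw w @` X).

Definition Zn (X : set V) (n : nat) (t : R) : R :=
  if n is 0 then 1
  else \sum_(w : {dffun forall j : 'I_n, 'I_(N (1 + j))}) (normD X (phiw w)) `^ t.

Definition cmin (X : set V) (n : nat) : R :=
  inf [set normD X (phi a) | a in [set: 'I_(N n)]].

Definition rho (X : set V) (n : nat) : R :=
  sup [set normD X (phi p.1) / normD X (phi p.2) | p in [set: 'I_(N n) * 'I_(N n)]].

Definition maxrho (X : set V) (n : nat) : R :=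
  \big[Num.max/0]_(1 <= j < n.+1) rho X j.

Definition Ztilde (X : set V) (n : nat) (t : R) : R :=
  Zn X n.-1 t * (N n)%:R `^ (t / d%:R) * cmin X n `^ t.

End NCIFS.

Section Hausdorff.
Variables (R : realType) (d : nat).
Local Notation V := 'rV[R]_d.

Definition ediam (U : set V) : \bar R :=
  ereal_sup [set (eucl_norm (p.1 - p.2))%:E | p in U `*` U].

Definition diam_pow (s : R) (U : set V) : \bar R :=
  if U == set0 then 0%E else ((fine (ediam U)) `^ s)%:E.

Definition hausdorff_delta (s delta : R) (A : set V) : \bar R :=
  ereal_inf [set (\sum_(0 <= i <oo) diam_pow s (U i))%E
            | U in [set U : nat -> set V |
                    A `<=` \bigcup_i U i /\ forall i, (ediam (U i) <= delta%:E)%E]].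

Definition hausdorff_measure (s : R) (A : set V) : \bar R :=
  ereal_sup [set hausdorff_delta s delta A | delta in [set delta : R | 0 < delta]].

Definition hausdorff_dim (A : set V) : \bar R :=
  ereal_inf [set s%:E | s in [set s : R | 0 <= s /\ hausdorff_measure s A = 0%E]].

End Hausdorff.

(* Main.v *)
Require Import Defs.
From HB Require Import structures.
From mathcomp Require Import all_boot all_order all_algebra finmap ring lra.
From mathcomp Require Import all_classical all_reals all_analysis.
Set Implicit Arguments.
Unset Strict Implicit.
Unset Printing Implicit Defensive.
Import Order.TTheory GRing.Theory Num.Theory.
Import numFieldNormedType.Exports.
Local Open Scope classical_set_scope.
Local Open Scope ring_scope.

(* Mass distribution without measures: if a set of dimension parameter [s < t]
   were null, the compact limit set would be covered by finitely many balls
   with [sum r_i^t] small, so for large [n] every cylinder [phi_w(X)] of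
   length [n] hits one of them, and it is enough to show that the words of
   length [n] hitting a ball of radius [r] have total weight
   [sum |D phi_w|^t <= M r^t Z_n(t)].

   Cut each such word at its first prefix of size [<= r].  The small children
   of one parent [u] of length [i] have, by a volume count, total weight
   [O(r^t Z_n / Ztilde_{i+1})].  The words of size [> r] hitting the ball form
   a tree, and volume counting bounds each antichain in it; summing along the
   branches ending at its leaves, parents on one branch occupy only
   [O(1 + log max rho)] consecutive levels, because all children of the first
   parent already have size [O(rho r)] and the maps contract uniformly.  This
   is the loss compensated by the denominator in the hypothesis.  The case
   [t > d] cannot occur, since then [Ztilde_n] tends to [0]. *)

(** * Euclidean norm *)

(** The form of [Ztilde] comes from one exponent count. Children of [u] of size at most [r] that
    meet the ball satisfy sum S^d <= C r^d; there are at most [N i] of them, so their sum of S^t is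
    at most (1 + C) r^t N_i^(1 - t/d). Bounded distortion gives Z_i N_i c_i^t (tail sum) <= K^(2t)
    Z_n. Multiplying the two leaves exactly Z_i N_i^(t/d) c_i^t in the denominator. The obstacle is
    that different words are cut at different levels, while 1/Ztilde has no monotonicity in the
    level. It is therefore first replaced by the antitone bound 1 / (c (1 + ln max rho)); a branch
    then costs its number of parent levels times the value at the first one, and the two logarithmic
    factors cancel. All geometry enters through one packing estimate for antichains. It needs a ball
    of proportional radius inside [X] near every point at every small scale, which is what the
    assumption on the domain provides, and a quantitative open mapping property of the conformal
    maps. Grid counting uses the max-norm and conformality the Euclidean norm; each change of norm
    costs a factor [d]. *)

Section EuclideanNorm.
Variables (R : realType) (d : nat).
Implicit Types u v w : 'rV[R]_d.

Definition dotp u v : R := \sum_(i < d) u ord0 i * v ord0 i.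

Lemma dotpDl u v w : dotp (u + v) w = dotp u w + dotp v w.
Proof. by rewrite /dotp -big_split; apply: eq_bigr => i _; rewrite mxE mulrDl. Qed.

Lemma dotpZl c u w : dotp (c *: u) w = c * dotp u w.
Proof. by rewrite /dotp mulr_sumr; apply: eq_bigr => i _; rewrite mxE mulrA. Qed.

Lemma dotpC u v : dotp u v = dotp v u.
Proof. by apply: eq_bigr => i _; rewrite mulrC. Qed.

Lemma dotpp_ge0 u : 0 <= dotp u u.
Proof. by apply: sumr_ge0 => i _; rewrite -expr2 sqr_ge0. Qed.

Lemma eucl_normE u : eucl_norm u = Num.sqrt (dotp u u).
Proof. by congr Num.sqrt; apply: eq_bigr => i _; rewrite expr2. Qed.

Lemma eucl_norm_ge0 u : 0 <= eucl_norm u.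
Proof. exact: sqrtr_ge0. Qed.

Lemma eucl_norm_sq u : eucl_norm u ^+ 2 = dotp u u.
Proof. by rewrite eucl_normE sqr_sqrtr // dotpp_ge0. Qed.

Lemma coord_le_eucl u i : `|u ord0 i| <= eucl_norm u.
Proof.
rewrite -sqrtr_sqr eucl_normE ler_wsqrtr // /dotp (bigD1 i) //= -expr2.
by rewrite lerDl sumr_ge0 // => j _; rewrite -expr2 sqr_ge0.
Qed.

Lemma normr_rV_le u (c : R) : 0 <= c -> (forall i, `|u ord0 i| <= c) -> `|u| <= c.
Proof.
move=> c0 H; rewrite [leLHS]/Num.norm /= mx_normrE; apply/bigmax_leP; split=> // -[i j] _ /=.
by rewrite ord1.
Qed.

Lemma coord_le_normr u i : `|u ord0 i| <= `|u|.
Proof.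
rewrite [leRHS]/Num.norm /= mx_normrE.
exact: (le_bigmax 0 (fun ij : 'I_1 * 'I_d => `|u ij.1 ij.2|) (ord0, i)).
Qed.

Lemma normr_le_eucl u : `|u| <= eucl_norm u.
Proof. by apply: normr_rV_le => [|i]; [exact: eucl_norm_ge0|exact: coord_le_eucl]. Qed.

Lemma eucl_le_normr u : eucl_norm u <= d%:R * `|u|.
Proof.
rewrite -(ler_pXn2r (_ : 0 < 2)%N) ?nnegrE ?mulr_ge0 ?eucl_norm_ge0 //.
rewrite eucl_norm_sq exprMn.
apply: (@le_trans _ _ (\sum_(i < d) `|u| ^+ 2)).
  apply: ler_sum => i _; rewrite -expr2 -real_normK ?num_real //.
  by rewrite ler_pXn2r ?nnegrE // coord_le_normr.
rewrite sumr_const card_ord -[leLHS]mulr_natl ler_wpM2r ?sqr_ge0 //.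
by rewrite -natrX ler_nat; case: (d) => // k; rewrite expnS expn1 leq_pmulr.
Qed.

Lemma eucl_norm0_eq0 u : eucl_norm u = 0 -> u = 0.
Proof.
move=> u0; apply/rowP => i; rewrite mxE; apply/eqP; rewrite -normr_le0.
by rewrite -u0 coord_le_eucl.
Qed.

Lemma eucl_normZ c u : eucl_norm (c *: u) = `|c| * eucl_norm u.
Proof.
rewrite !eucl_normE dotpZl dotpC dotpZl mulrA -expr2 sqrtrM ?sqr_ge0 //.
by rewrite sqrtr_sqr.
Qed.

Lemma eucl_norm0 : eucl_norm (0 : 'rV[R]_d) = 0.
Proof. by rewrite -(scale0r 0) eucl_normZ normr0 mul0r. Qed.

Lemma eucl_normN u : eucl_norm (- u) = eucl_norm u.
Proof. by rewrite -scaleN1r eucl_normZ normrN1 mul1r. Qed.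

Lemma eucl_distC u v : eucl_norm (u - v) = eucl_norm (v - u).
Proof. by rewrite -opprB eucl_normN. Qed.

Lemma dotp_le u v : dotp u v <= eucl_norm u * eucl_norm v.
Proof.
have [/eucl_norm0_eq0 ->|u0] := eqVneq (eucl_norm u) 0.
  by rewrite eucl_norm0 mul0r -(scale0r 0) dotpZl mul0r.
have [/eucl_norm0_eq0 ->|v0] := eqVneq (eucl_norm v) 0.
  by rewrite eucl_norm0 mulr0 dotpC -(scale0r 0) dotpZl mul0r.
set a := eucl_norm u in u0 *; set b := eucl_norm v in v0 *.
have a0 : 0 < a by rewrite lt_def u0 eucl_norm_ge0.
have b0 : 0 < b by rewrite lt_def v0 eucl_norm_ge0.
have : 0 <= dotp (b *: u - a *: v) (b *: u - a *: v) by exact: dotpp_ge0.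
rewrite -scaleNr !(dotpDl, dotpZl) ![dotp _ (_ + _)]dotpC !(dotpDl, dotpZl).
rewrite -!eucl_norm_sq -/a -/b (dotpC v u) => H.
have H2 : 0 <= 2 * (a * b) * (a * b - dotp u v).
  by apply: le_trans H _; rewrite le_eqVlt; apply/orP; left; apply/eqP; ring.
by move: H2; rewrite pmulr_rge0 ?subr_ge0 // !mulr_gt0.
Qed.

Lemma ler_euclD u v : eucl_norm (u + v) <= eucl_norm u + eucl_norm v.
Proof.
rewrite -(ler_pXn2r (_ : 0 < 2)%N) ?nnegrE ?addr_ge0 ?eucl_norm_ge0 //.
rewrite eucl_norm_sq sqrrD !eucl_norm_sq !dotpDl ![dotp _ (_ + _)]dotpC !dotpDl.
have := dotp_le u v; rewrite (dotpC v u); lra.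
Qed.

Lemma ler_eucl_distD w u v : eucl_norm (u - v) <= eucl_norm (u - w) + eucl_norm (w - v).
Proof. by apply: le_trans (ler_euclD _ _); rewrite addrA subrK. Qed.

Lemma ler_sub_euclB u v : eucl_norm u - eucl_norm v <= eucl_norm (u - v).
Proof. by rewrite lerBlDr; apply: le_trans (ler_euclD _ _); rewrite subrK. Qed.

Lemma eucl_norm_continuous : continuous (@eucl_norm R d).
Proof.
move=> u; apply/(@cvgrPdist_lt _ _ _ _ (nbhs_filter u)) => e e0; apply/nbhs_ballP.
exists (e / (d%:R + 1)) => /= [|v]; first by rewrite divr_gt0 // ltr_pwDr.
rewrite -ball_normE /= => uv.
have : eucl_norm (u - v) < e.
  apply: le_lt_trans (eucl_le_normr _) _.
  apply: (@le_lt_trans _ _ ((d%:R + 1) * `|u - v|)).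
    by rewrite ler_wpM2r // lerDl.
  by rewrite mulrC -ltr_pdivlMr ?ltr_pwDr.
apply: le_lt_trans; rewrite ler_norml; apply/andP; split.
  by rewrite lerNl opprB eucl_distC ler_sub_euclB.
exact: ler_sub_euclB.
Qed.

Lemma eucl_norm_delta i : eucl_norm (delta_mx ord0 i : 'rV[R]_d) = 1.
Proof.
rewrite eucl_normE /dotp (bigD1 i) //= big1 ?addr0.
  by rewrite mxE !eqxx mulr1 sqrtr1.
by move=> j ji; rewrite mxE eqxx /= (negbTE ji) mul0r.
Qed.

End EuclideanNorm.

(** * Packing of cubes *)

Section Packing.

Lemma sum_card_disjoint (T : finType) (I : eqType) (L : seq I) (S : I -> pred T) :
  uniq L ->
  (forall i j f, i \in L -> j \in L -> i != j -> S i f -> ~~ S j f) ->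
  (\sum_(i <- L) #|S i| <= #|T|)%N.
Proof.
move=> uL dS.
rewrite (eq_bigr (fun i => \sum_(f : T) S i f)%N); last first.
  by move=> i _; rewrite -sum1_card big_mkcond; apply: eq_bigr => f _; rewrite unfold_in; case: (S i f).
rewrite exchange_big /= -sum1_card; apply: leq_sum => f _.
elim: L uL dS => [|i L IH] /= => [_ _|/andP[iL uL] dS]; first by rewrite big_nil.
rewrite big_cons; have [Sif|_] := boolP (S i f); last first.
  by apply: IH => // j k g jL kL; apply: dS; rewrite in_cons (jL, kL) orbT.
rewrite big_seq big1 // => j jL; apply/eqP; rewrite eqb0.
apply: dS Sif; rewrite ?in_cons ?eqxx ?jL ?orbT //.
by apply: contraNneq iL => ->.
Qed.

Lemma finite_lower_bound (R : realType) (T : eqType) (L : seq T) (f : T -> R) :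
  {in L, forall x, 0 < f x} -> exists2 m : R, 0 < m & {in L, forall x, m <= f x}.
Proof.
elim: L => [|x L IH] H; first by exists 1.
have [y yL|m m0 Hm] := IH; first by apply: H; rewrite in_cons yL orbT.
exists (Num.min m (f x)); first by rewrite lt_min m0 H // mem_head.
move=> y; rewrite in_cons => /orP[/eqP->|yL]; rewrite ge_min ?lexx ?orbT //.
by rewrite Hm.
Qed.

Lemma ball_rVP (R : realType) d (x y : 'rV[R]_d) e : 0 < e ->
  (forall j, `|x ord0 j - y ord0 j| < e) -> ball x e y.
Proof. by move=> e0 H; split=> // i j; rewrite ord1; apply: H. Qed.

(* Grid points of mesh [delta] are counted: the cube of radius [rad i] contains
   at least [(rad i / (2 delta))^d] of them, the big cube at most
   [(4 Rad / delta)^d]. *)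
Lemma cube_packing (R : realType) d (I : eqType) (L : seq I) (c : I -> 'rV[R]_d)
    (rad : I -> R) (x0 : 'rV[R]_d) (Rad : R) :
  uniq L -> 0 <= Rad -> (forall i, i \in L -> 0 < rad i) ->
  (forall i j, i \in L -> j \in L -> i != j ->
     ball (c i) (rad i) `&` ball (c j) (rad j) = set0) ->
  (forall i, i \in L -> `|c i - x0| + rad i <= Rad) ->
  \sum_(i <- L) rad i ^+ d <= (8 * Rad) ^+ d.
Proof.
move=> uL Rad0 rad0 dis inR.
have [->|L0] := eqVneq L [::]; first by rewrite big_nil exprn_ge0 // mulr_ge0.
(* The mesh is below every radius, so each cube spans at least one cell; [delta <= Rad] lets the
   rounding in [M] be absorbed into the factor 8. *)
have [delta delta0 dle] := finite_lower_bound rad0.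
have dR : delta <= Rad.
  case: L L0 {uL} rad0 dis inR dle => // i L _ rad0 _ /(_ i (mem_head _ _)) inR dle.
  apply: le_trans (dle i (mem_head _ _)) _; apply: le_trans inR.
  by rewrite lerDr.
pose M := (Num.truncn (2 * Rad / delta)).+2.
pose T := {ffun 'I_d -> 'I_M}.
pose pt (f : T) : 'rV[R]_d := \row_j (x0 ord0 j - Rad + delta * (f j)%:R).
pose S i : pred T := fun f => `[< ball (c i) (rad i) (pt f) >].
have cardS i : i \in L -> rad i ^+ d <= (2 * delta) ^+ d * #|S i|%:R.
  move=> iL; have ri := rad0 _ iL.
  pose q := Num.truncn (rad i / delta).
  have q1 : 1 <= rad i / delta by rewrite ler_pdivlMr // mul1r dle.
  have := truncn_itv (le_trans ler01 q1); rewrite -/q => /andP[qle qlt].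
  have q0 : (0 < q)%N.
    by rewrite lt0n; apply: contraTneq qlt => ->; rewrite -leNgt.
  have q1' : (1 : R) <= q%:R by rewrite ler1n.
  (* [a j] is the lower face of the cube in grid units. The [q] indices starting just above it reach
     at most [a j + rad i / delta], while the upper face is at [a j + 2 * (rad i / delta)]. *)
  pose a j := (c i ord0 j - rad i - (x0 ord0 j - Rad)) / delta.
  have cx j : `|c i ord0 j - x0 ord0 j| + rad i <= Rad.
    apply: le_trans (inR _ iL); rewrite lerD2r.
    by have := coord_le_normr (c i - x0) j; rewrite !mxE.
  have a0 j : 0 <= a j.
    rewrite divr_ge0 ?(ltW delta0) //.
    have := cx j; have := ler_norm (- (c i ord0 j - x0 ord0 j)); rewrite normrN; lra.
  have a1 j : a j + 2 * (rad i / delta) <= 2 * Rad / delta.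
    rewrite /a mulrA -mulrDl ler_pM2r ?invr_gt0 //.
    have := cx j; have := ler_norm (c i ord0 j - x0 ord0 j); lra.
  pose lo j := (Num.truncn (a j)).+1.
  have hlo j : a j < (lo j)%:R <= a j + 1.
    have /andP[h1 h2] := truncn_itv (a0 j).
    by rewrite h2 /lo /= -natr1 lerD2r.
  have inM (j : 'I_d) (k : 'I_q) : (lo j + k < M)%N.
    rewrite -(ltr_nat R) natrD /M -[_.+2]addn2 natrD.
    have Rd0 : 0 <= 2 * Rad / delta by rewrite divr_ge0 ?mulr_ge0 // ltW.
    have /andP[_ h] := truncn_itv Rd0; rewrite -natr1 in h.
    have /andP[_ h1] := hlo j.
    have : (k%:R : R) + 1 <= q%:R by rewrite natr1 ler_nat.
    have := a1 j; lra.
  pose g (f : {ffun 'I_d -> 'I_q}) : T := [ffun j => Ordinal (inM j (f j))].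
  have ginj : injective g.
    move=> f1 f2 /ffunP H; apply/ffunP => j; have := H j; rewrite !ffunE.
    by move=> /(congr1 val) /= /addnI /val_inj.
  have : (#|codom g| <= #|S i|)%N.
    apply: subset_leq_card; apply/fintype.subsetP => _ /codomP[f ->].
    rewrite unfold_in; apply/asboolP; apply: ball_rVP => // j.
    rewrite mxE ffunE /= natrD.
    have /andP[h1 h2] := hlo j.
    have h3 : ((f j)%:R : R) + 1 <= q%:R by rewrite natr1 ler_nat.
    have h4 : a j < (lo j)%:R + (f j)%:R < a j + 2 * (rad i / delta).
      by apply/andP; split; [rewrite ltr_wpDr|lra].
    have aE : delta * a j = c i ord0 j - rad i - (x0 ord0 j - Rad).
      by rewrite /a mulrC divfK // gt_eqF.
    have rE : delta * (rad i / delta) = rad i by rewrite mulrC divfK // gt_eqF.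
    move: h4; set w := (lo j)%:R + _.
    move=> /andP[]; rewrite -(ltr_pM2l delta0) aE => h5.
    rewrite -(ltr_pM2l delta0).
    have -> : delta * (a j + 2 * (rad i / delta)) =
              delta * a j + 2 * (delta * (rad i / delta)) by ring.
    rewrite rE aE => h6; rewrite ltr_norml; apply/andP; split; lra.
  rewrite card_codom // card_ffun !card_ord => h.
  apply: (@le_trans _ _ ((2 * delta) ^+ d * (q ^ d)%:R)); last first.
    by rewrite ler_wpM2l ?ler_nat // exprn_ge0 // mulr_ge0 // ltW.
  rewrite natrX -exprMn lerXn2r ?nnegrE ?mulr_ge0 // ?(ltW ri) ?(ltW delta0) //.
  rewrite mulrAC -ler_pdivrMr //; move: qlt; rewrite -natr1; lra.
have sumS : (\sum_(i <- L) #|S i| <= M ^ d)%N.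
  have -> : (M ^ d = #|T|)%N by rewrite card_ffun !card_ord.
  apply: sum_card_disjoint => // i j f iL jL ij /asboolP h1.
  apply/negP => /asboolP h2.
  by have /seteqP[/(_ _ (conj h1 h2))] := dis _ _ iL jL ij.
apply: (@le_trans _ _ (\sum_(i <- L) (2 * delta) ^+ d * #|S i|%:R)).
  by rewrite big_seq [leRHS]big_seq; apply: ler_sum.
rewrite -mulr_sumr -natr_sum.
apply: (@le_trans _ _ ((2 * delta) ^+ d * (M ^ d)%:R)).
  by rewrite ler_wpM2l ?ler_nat // exprn_ge0 // mulr_ge0 // ltW.
have Rd1 : 1 <= Rad / delta by rewrite ler_pdivlMr // mul1r.
rewrite natrX -exprMn lerXn2r ?nnegrE ?mulr_ge0 // ?(ltW delta0) //.
rewrite mulrAC -ler_pdivlMr //.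
have /andP[h _] : (Num.truncn (2 * Rad / delta))%:R <= 2 * Rad / delta < (Num.truncn (2 * Rad / delta)).+1%:R.
  by apply: truncn_itv; rewrite -mulrA mulr_ge0 // (le_trans ler01).
have -> : M%:R = (Num.truncn (2 * Rad / delta))%:R + 2 :> R by rewrite /M -addn2 natrD.
by move: h Rd1; rewrite -!mulrA; lra.
Qed.

End Packing.

(** * Conformal maps *)

Section ConformalMaps.
Variables (R : realType) (d : nat).
Local Notation V := 'rV[R]_d.
Implicit Types (f g : V -> V) (x y z u v w q : V).

Definition conformal_at f x := differentiable f x /\
  exists2 lam : R, 0 < lam & forall v, eucl_norm ('d f x v) = lam * eucl_norm v.

Hypothesis d0 : (0 < d)%N.

(** Rules out the degenerate case of dimension 0, where the unit sphere is empty and the supremum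
    [scalef] takes its default value 0. *)
Lemma exists_unit : exists v : V, eucl_norm v = 1.
Proof. by exists (delta_mx ord0 (Ordinal d0)); rewrite eucl_norm_delta. Qed.

Lemma scalefE f x lam : 0 < lam ->
  (forall v, eucl_norm ('d f x v) = lam * eucl_norm v) -> scalef f x = lam.
Proof.
move=> lam0 H; rewrite /scalef.
suff -> : [set eucl_norm ('d f x v) | v in [set v : V | eucl_norm v = 1]] = [set lam].
  by rewrite sup1.
apply/seteqP; split=> [_ [v /= v1 <-]|_ ->] /=; first by rewrite H v1 mulr1.
by have [v v1] := exists_unit; exists v => //=; rewrite H v1 mulr1.
Qed.

Lemma scalef_gt0 f x : conformal_at f x -> 0 < scalef f x.
Proof. by move=> [_ [lam lam0 H]]; rewrite (scalefE lam0 H). Qed.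

Lemma conformalE f x v : conformal_at f x ->
  eucl_norm ('d f x v) = scalef f x * eucl_norm v.
Proof. by move=> [_ [lam lam0 H]]; rewrite (scalefE lam0 H). Qed.

Lemma conformal_at_id x : conformal_at id x.
Proof.
split=> //; exists 1 => // v; rewrite mul1r.
by rewrite (_ : 'd id x v = v) // diff_val.
Qed.

Lemma scalef_id x : scalef id x = 1.
Proof. by apply: scalefE => // v; rewrite mul1r diff_val. Qed.

Lemma conformal_at_comp f g x : conformal_at g x -> conformal_at f (g x) ->
  conformal_at (f \o g) x /\ scalef (f \o g) x = scalef f (g x) * scalef g x.
Proof.
move=> cg cf; have [[dg _] [df _]] := (cg, cf).
have H v : eucl_norm ('d (f \o g) x v) = scalef f (g x) * scalef g x * eucl_norm v.
  by rewrite diff_comp //= conformalE // conformalE // mulrA.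
have l0 : 0 < scalef f (g x) * scalef g x by rewrite mulr_gt0 // scalef_gt0.
by split; [split; [exact: differentiable_comp|exists (scalef f (g x) * scalef g x)]|exact: scalefE].
Qed.

Lemma diff_expansion f x (eps : R) : differentiable f x -> 0 < eps ->
  exists2 delta : R, 0 < delta & forall h, `|h| < delta ->
    `|f (x + h) - f x - 'd f x h| <= eps * `|h|.
Proof.
move=> df e0; have := diff_locallyxC df.
set k := the_littleo _ _ _ _ _ => H.
have /nbhs_ballP[delta /= delta0 Hd] : \forall h \near (0 : V), `|k h| <= eps * `|h|.
  by have := @littleoP _ _ _ _ _ _ [littleo of k] _ e0.
exists delta => // h hd; rewrite H -addrA -opprD addrC addKr.
by apply: Hd; rewrite -ball_normE /= sub0r normrN.
Qed.

(** A map multiplying Euclidean norms by a positive factor has zero kernel, so its square matrix is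
    invertible. *)
Lemma diff_surj f x w : conformal_at f x -> exists v, 'd f x v = w.
Proof.
move=> cf; pose M := lin1_mx ('d f x).
have MU : M \in unitmx.
  rewrite -row_free_unit -kermx_eq0; apply/eqP/row_matrixP => i; rewrite row0.
  apply: eucl_norm0_eq0; apply/eqP.
  have /eqP := conformalE (row i (kermx M)) cf.
  rewrite -mul_rV_lin1 -/M -row_mul mulmx_ker row0 eucl_norm0 eq_sym mulf_eq0.
  by rewrite gt_eqF ?scalef_gt0.
by exists (w *m invmx M); rewrite -mul_rV_lin1 mulmxKV.
Qed.

Lemma eucl_dist_continuous z : continuous (fun x : V => eucl_norm (x - z)).
Proof.
move=> x; apply: (@continuous_comp _ _ _ (fun x : V => x - z) (@eucl_norm R d)).
  by apply: (@continuousB _ _ _ id (fun=> z)); [exact: cvg_id|exact: cst_continuous].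
exact: eucl_norm_continuous.
Qed.

Lemma eucl_ball_compact z (s : R) : compact [set x | eucl_norm (x - z) <= s].
Proof.
apply: bounded_closed_compact.
  exists (`|z| + s); split; first exact: num_real.
  move=> M HM x /= xs; apply/ltW/(le_lt_trans _ HM).
  rewrite -[x](subrK z) addrC; apply: le_trans (ler_normD _ _) _.
  by rewrite lerD2l; apply: le_trans xs; exact: normr_le_eucl.
have -> : [set x : V | eucl_norm (x - z) <= s] =
    (fun x : V => eucl_norm (x - z)) @^-1` [set r | r <= s] by [].
apply: preimage_closed; last exact: closed_le.
by move=> x _; exact: eucl_dist_continuous.
Qed.

(* At a minimiser [c] of [|f x - q| + l1 |x - z|] with [l1 < l0], moving along
   [v] with [Df(c) v = q - f c] would decrease the functional unless [f c = q]. *)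
Lemma conformal_open_mapping f z q (s l0 : R) : 0 < s ->
  (forall x, eucl_norm (x - z) <= s -> conformal_at f x /\ l0 <= scalef f x) ->
  eucl_norm (q - f z) < l0 * s ->
  exists2 x, eucl_norm (x - z) < s & f x = q.
Proof.
move=> s0 Hf Hq.
(* [l1 * s] exceeds the value of the functional at [z], which keeps the minimiser off the sphere of
   radius [s]; [l1 < l0] leaves room for a strict decrease. *)
have [l1 l1q l1l0] : exists2 l1, eucl_norm (q - f z) < l1 * s & l1 < l0.
  exists ((eucl_norm (q - f z) / s + l0) / 2).
    by rewrite -ltr_pdivrMr // midf_lt // ltr_pdivrMr.
  by rewrite midf_lt // ltr_pdivrMr.
have l10 : 0 < l1.
  by rewrite -(pmulr_lgt0 _ s0); apply: le_lt_trans l1q; exact: eucl_norm_ge0.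
pose A := [set x | eucl_norm (x - z) <= s].
pose h x := eucl_norm (f x - q) + l1 * eucl_norm (x - z).
have hc : {within A, continuous h}.
  apply: continuous_in_subspaceT => x; rewrite inE => Ax.
  have [[df _] _] := Hf _ Ax.
  apply: (@continuousD _ _ _ (fun x => eucl_norm (f x - q)) (fun x => l1 * eucl_norm (x - z))).
    apply: (@continuous_comp _ _ _ f (fun y => eucl_norm (y - q))).
      exact: differentiable_continuous.
    exact: eucl_dist_continuous.
  apply: (@continuousM _ _ (fun=> l1) (fun x => eucl_norm (x - z))); first exact: cst_continuous.
  exact: eucl_dist_continuous.
have [|c] := EVT_min_rV _ (@eucl_ball_compact z s) hc.
  by exists z => /=; rewrite subrr eucl_norm0 ltW.
rewrite inE /= => cA cmin.
have hcz : h c < l1 * s.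
  have zA : z \in [set x | eucl_norm (x - z) <= s].
    by rewrite inE /= subrr eucl_norm0 ltW.
  apply: le_lt_trans l1q; apply: le_trans (cmin z zA) _.
  by rewrite /h subrr eucl_norm0 mulr0 addr0 eucl_distC.
have cs : eucl_norm (c - z) < s.
  rewrite -(ltr_pM2l l10); apply: le_lt_trans hcz; rewrite /h lerDr.
  exact: eucl_norm_ge0.
exists c => //; apply/eqP; rewrite -subr_eq0; apply/eqP/eucl_norm0_eq0/eqP.
apply: contraT => fcq.
have e0 : 0 < eucl_norm (f c - q) by rewrite lt_def fcq eucl_norm_ge0.
have [cf ls] := Hf _ cA; have [df _] := cf.
have [v dv] := diff_surj (q - f c) cf.
have lv : scalef f c * eucl_norm v = eucl_norm (f c - q).
  by rewrite -conformalE // dv eucl_distC.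
have v0 : 0 < eucl_norm v by rewrite -(pmulr_rgt0 _ (scalef_gt0 cf)) lv.
(* The remainder is controlled in the max-norm and its Euclidean norm costs a factor [d%:R]; this
   choice still gives [d%:R * eps < l0 - l1]. *)
pose eps := (l0 - l1) / (2 * (d%:R + 1)).
have d10 : 0 < d%:R + 1 :> R by rewrite ltr_pwDr.
have eps0 : 0 < eps by rewrite divr_gt0 ?subr_gt0 // mulr_gt0.
have [delta delta0 Hdelta] := diff_expansion df eps0.
pose m := Num.min delta (s - eucl_norm (c - z)).
have m0 : 0 < m by rewrite lt_min delta0 subr_gt0.
pose tau := Num.min 1 (m / (eucl_norm v + 1)).
have v10 : 0 < eucl_norm v + 1 by rewrite ltr_wpDr // ltW.
have tau0 : 0 < tau by rewrite lt_min ltr01 divr_gt0.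
have tau1 : tau <= 1 by rewrite ge_min lexx.
have tauv : tau * eucl_norm v < m.
  apply: (@lt_le_trans _ _ (tau * (eucl_norm v + 1))).
    by rewrite ltr_pM2l // ltrDl.
  by rewrite -ler_pdivlMr // ge_min lexx orbT.
have tv : eucl_norm (tau *: v) = tau * eucl_norm v by rewrite eucl_normZ gtr0_norm.
have xA : eucl_norm (c + tau *: v - z) <= s.
  rewrite addrAC; apply: le_trans (ler_euclD _ _) _; rewrite tv.
  have : m <= s - eucl_norm (c - z) by rewrite ge_min lexx orbT.
  by have := ltW tauv; lra.
have xA' : c + tau *: v \in [set x | eucl_norm (x - z) <= s] by rewrite inE.
have := cmin _ xA'; rewrite leNgt => /negP; apply: contra_notT => _.
rewrite /h.
have rem : eucl_norm (f (c + tau *: v) - f c - 'd f c (tau *: v)) <=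
    d%:R * (eps * (tau * eucl_norm v)).
  apply: le_trans (eucl_le_normr _) _; rewrite ler_wpM2l //.
  apply: le_trans (Hdelta _ _) _.
    apply: le_lt_trans (normr_le_eucl _) _; rewrite tv; apply: lt_le_trans tauv _.
    by rewrite ge_min lexx.
  by rewrite ler_pM2l // -tv; exact: normr_le_eucl.
have main : eucl_norm (f (c + tau *: v) - q) <=
    d%:R * (eps * (tau * eucl_norm v)) + (1 - tau) * eucl_norm (f c - q).
  apply: le_trans (lerD rem (lexx _)).
  have -> : (1 - tau) * eucl_norm (f c - q) = eucl_norm ((1 - tau) *: (f c - q)).
    by rewrite eucl_normZ ger0_norm // subr_ge0.
  apply: le_trans (ler_euclD _ _); rewrite le_eqVlt; apply/orP; left; apply/eqP.
  congr eucl_norm; rewrite linearZ /= dv scalerBl scale1r.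
  rewrite -[q - f c]opprB scalerN opprK [_ - tau *: _]addrC addrA addrK.
  by rewrite addrA subrK.
have zz : eucl_norm (c + tau *: v - z) <= eucl_norm (c - z) + tau * eucl_norm v.
  by rewrite addrAC; apply: le_trans (ler_euclD _ _) _; rewrite tv.
apply: (@le_lt_trans _ _ (d%:R * (eps * (tau * eucl_norm v)) +
   (1 - tau) * eucl_norm (f c - q) + l1 * (eucl_norm (c - z) + tau * eucl_norm v))).
  by apply: lerD => //; rewrite ler_pM2l.
rewrite -lv.
have deps : d%:R * eps < l0 - l1.
  rewrite /eps mulrA ltr_pdivrMr ?mulr_gt0 //.
  by have := subr_gt0 l1 l0; rewrite l1l0 => h0; nra.
rewrite -subr_gt0.
have -> : scalef f c * eucl_norm v + l1 * eucl_norm (c - z) -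
 (d%:R * (eps * (tau * eucl_norm v)) + (1 - tau) * (scalef f c * eucl_norm v) +
  l1 * (eucl_norm (c - z) + tau * eucl_norm v)) =
  (tau * eucl_norm v) * (scalef f c - l1 - d%:R * eps) by ring.
by apply: mulr_gt0; [exact: mulr_gt0|lra].
Qed.

Lemma dotp_continuous u : continuous (fun w : V => dotp w u).
Proof.
move=> w; rewrite /dotp.
have -> : (fun w : V => \sum_(i < d) w ord0 i * u ord0 i) =
          \sum_(i < d) (fun w : V => w ord0 i * u ord0 i).
  by apply/funext => a; rewrite fct_sumE.
apply/differentiable_continuous/differentiable_sum => i.
by apply: differentiableM; [exact: differentiable_coord|exact: differentiable_cst].
Qed.

Lemma diff_dotp u w : is_diff w (fun w : V => dotp w u : R) (fun w => dotp w u).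
Proof.
have lin : linear (fun w : V => dotp w u : R).
  by move=> a b c; rewrite dotpDl dotpZl.
pose M := GRing.isLinear.Build _ _ _ _ _ lin.
pose L : {linear V -> R} := HB.pack (fun w : V => dotp w u : R) M.
have cL : continuous L by exact: dotp_continuous.
rewrite -[fun w => _]/(L : V -> R).
by apply: DiffDef; [exact: linear_differentiable|rewrite diff_lin].
Qed.

(** Vector-valued maps satisfy no mean value equality, so it is applied to the scalar function
    [s |-> dotp (f (x + s *: (y - x))) u] with [u = f y - f x]; Cauchy-Schwarz and division by the
    norm of [u] conclude. *)
Lemma conformal_mean_value f x y (L : R) :
  (forall s : R, 0 <= s <= 1 ->
     conformal_at f (x + s *: (y - x)) /\ scalef f (x + s *: (y - x)) <= L) ->
  eucl_norm (f y - f x) <= L * eucl_norm (y - x).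
Proof.
move=> H; set u := f y - f x.
pose p (s : R) := x + s *: (y - x).
pose h (s : R) := dotp (f (p s)) u.
have dh (s : R) : 0 <= s <= 1 -> is_derive s 1 h (dotp ('d f (p s) (y - x)) u).
  move=> s01; have [[df _] _] := H s s01.
  have dp : is_diff s p (fun r : R => r *: (y - x)).
    have := @is_diffD _ _ _ (cst x) (fun r : R => r *: (y - x)) _ _ s
      (is_diff_cst x s) (is_diff_scalel s (y - x)).
    by move=> h0; apply: is_diff_eq h0 _; apply/funext => r /=; rewrite add0r.
  have df' := differentiableP df.
  have dd : is_diff s h ((fun w => dotp w u) \o ('d f (p s) \o (fun r : R => r *: (y - x)))).
    have := @is_diff_comp _ _ _ _ (f \o p) _ (fun w : V => dotp w u) _ s
      (@is_diff_comp _ _ _ _ p _ f _ s dp df') (diff_dotp u _).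
    by [].
  apply: DeriveDef; first by apply/diff_derivable/ex_diff.
  rewrite deriveE; last exact: ex_diff.
  by rewrite diff_val /= scale1r.
have [||s] := @MVT_segment R h (fun s => dotp ('d f (p s) (y - x)) u) 0 1 ler01.
- by move=> s; rewrite in_itv /= => /andP[s0 s1]; apply: dh; rewrite !ltW.
- apply: derivable_within_continuous => s; rewrite in_itv /= => s01.
  exact: (@ex_derive _ _ _ _ _ _ _ (dh _ s01)).
rewrite in_itv /= => s01 E.
have [cf ls] := H _ s01.
have uu : dotp u u = dotp ('d f (p s) (y - x)) u.
  rewrite -[RHS]mulr1 -[X in _ * X](subr0 1) -E /h /p scale1r scale0r addr0.
  by rewrite [x + _]addrC subrK -mulN1r -dotpZl -dotpDl scaleN1r.
have := dotp_le ('d f (p s) (y - x)) u; rewrite -uu -eucl_norm_sq conformalE // => H1.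
have [u0|u0] := leP (eucl_norm u) 0.
  apply: (le_trans u0); rewrite mulr_ge0 ?eucl_norm_ge0 //.
  by apply: le_trans ls; rewrite ltW // scalef_gt0.
rewrite -(ler_pM2r u0) -expr2; apply: le_trans H1 _.
by rewrite ler_pM2r // ler_wpM2r // eucl_norm_ge0.
Qed.

End ConformalMaps.

(** * Interior balls of the domain *)

Section InteriorBalls.
Variables (R : realType) (d : nat).
Local Notation V := 'rV[R]_d.
Implicit Types (X U : set V) (g : V -> R) (x y z v w : V).

(** An interior corkscrew condition in the max-norm. One constant serves both as the largest scale
    and as the ratio of radii, so that the condition is monotone in [e]. *)
Definition inner_balls X (e : R) x := forall r : R, 0 < r <= e ->
  exists z, `|z - x| <= r /\ forall y, `|y - z| < e * r -> X y.

Lemma inner_balls_mono X (e e' : R) x : 0 < e' <= e ->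
  inner_balls X e x -> inner_balls X e' x.
Proof.
move=> /andP[e'0 e'e] H r /andP[r0 re'].
have [|z [zx Hz]] := H r; first by rewrite r0 (le_trans re').
exists z; split=> // y yz; apply: Hz; apply: lt_le_trans yz _.
by rewrite ler_pM2r.
Qed.

(** Monotonicity in [e] lets finitely many local constants be replaced by a smaller common one. It
    serves for the inner balls and for the room that [X] has inside [U]. *)
Lemma compact_uniform_gt0 X (P : R -> V -> Prop) : compact X ->
  (forall e e' x, 0 < e' <= e -> P e x -> P e' x) ->
  (forall x0, X x0 ->
     exists2 e : R, 0 < e & forall x, X x -> `|x - x0| < e -> P e x) ->
  exists2 e : R, 0 < e & forall x, X x -> P e x.
Proof.
move=> /compact_near_coveringP/near_covering_withinP cX Pm Pl.
have H : \forall e \near (0:R)^'+, X `<=` P e.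
  apply: cX => x0 Xx0; have [e e0 He] := Pl _ Xx0.
  exists (ball x0 e, [set r | 0 < r < e]).
    split; first exact: nbhsx_ballx.
    by near=> r => /=; apply/andP; split; near: r; [exact: nbhs_right_gt|exact: nbhs_right_lt].
  move=> [x r] /= [xb /andP[r0 re]] Xx.
  apply: (Pm e); first by rewrite r0 ltW.
  by apply: He => //; move: xb; rewrite -ball_normE /= distrC.
near (0:R)^'+ => e.
exists e; first by near: e; exact: nbhs_right_gt.
by near: e.
Unshelve. all: by end_near. Qed.

Lemma compact_dist_bound X x : compact X -> exists2 D : R, 0 < D & forall y, X y -> `|y - x| <= D.
Proof.
move=> /compact_bounded [M [_ HM]].
exists (`|M| + 1 + `|x|) => [|y Xy].
  by rewrite -addrA ltr_wpDl // ltr_pwDl.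
apply: le_trans (ler_normB _ _) _; rewrite lerD2r; apply: HM => //.
by apply: le_lt_trans (ler_norm _) _; rewrite ltrDl.
Qed.

(** Take a ball of radius [r0] around an interior point [p]. The homothety of centre [x] and ratio
    [s = r / D] maps it into [X] by convexity; its centre moves to within [r] of [x] and its radius
    becomes [s * r0]. *)
Lemma convex_inner_balls X : compact X -> Defs.convex_set X -> closure (interior X) = X ->
  exists2 e : R, 0 < e & forall x, X x -> inner_balls X e x.
Proof.
move=> cX vX clX.
have [X0|/set0P[x0 Xx0]] := eqVneq X set0.
  by exists 1 => // x; rewrite X0.
have [p Xp] : interior X !=set0.
  by apply/set0P; apply: contraPneq Xx0 => iX; rewrite -clX iX closure0.
have /nbhs_ballP[r0 /= r00 pr] : nbhs p X by exact: Xp.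
have [D D0 HD] := compact_dist_bound p cX.
exists (Num.min D (r0 / D)); first by rewrite lt_min D0 divr_gt0.
move=> x Xx r /andP[rpos]; rewrite le_min => /andP[rD _].
pose s := r / D.
have s0 : 0 < s by rewrite divr_gt0.
have s1 : s <= 1 by rewrite ler_pdivrMr // mul1r.
exists (s *: p + (1 - s) *: x); split.
  have -> : s *: p + (1 - s) *: x - x = s *: (p - x).
    by rewrite scalerBl scale1r scalerBr addrA addrAC addrK.
  rewrite normrZ gtr0_norm // /s mulrAC ler_pdivrMr // ler_pM2l // distrC.
  exact: HD.
move=> y yz.
have -> : y = s *: (p + s^-1 *: (y - (s *: p + (1 - s) *: x))) + (1 - s) *: x.
  rewrite scalerDr scalerA mulfV ?gt_eqF // scale1r opprD !addrA.
  by rewrite [s *: p + y]addrC addrK subrK.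
apply: vX => //; last by rewrite s1 ltW.
apply: pr; rewrite -ball_normE /= opprD addrA subrr sub0r normrN normrZ.
rewrite gtr0_norm ?invr_gt0 // mulrC ltr_pdivrMr //.
apply: lt_le_trans yz _; rewrite /s mulrCA mulrC ler_pM2l //.
by rewrite mulrC ge_min lexx orbT.
Qed.

Lemma line_mean_value g x v (t : R) :
  (forall s : R, `|s| <= `|t| -> derivable g (x + s *: v) v) ->
  exists2 s : R, `|s| <= `|t| & g (x + t *: v) - g x = t * 'D_v g (x + s *: v).
Proof.
move=> H.
pose h (s : R) := g (x + s *: v).
have dh (s : R) : `|s| <= `|t| -> is_derive s 1 h ('D_v g (x + s *: v)).
  move=> /H; rewrite /derivable /derive => H'.
  have E : (fun r : R => r^-1 *: ((h \o shift s) (r *: (1 : R)) - h s)) =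
           (fun r : R => r^-1 *: ((g \o shift (x + s *: v)) (r *: v) - g (x + s *: v))).
    apply/funext => r /=; rewrite /h; congr (_ *: (g _ - _)).
    by rewrite [r%:A]mulr1 scalerDl addrCA.
  by apply: DeriveDef; rewrite /derivable /derive E.
have [t0|t0] := leP 0 t.
  have [||s] := @MVT_segment R h (fun s => 'D_v g (x + s *: v)) 0 t t0.
  - move=> s; rewrite in_itv /= => /andP[s0 s1]; apply: dh.
    by rewrite !ger0_norm // ltW.
  - apply: derivable_within_continuous => s; rewrite in_itv /= => /andP[s0 s1].
    by apply: (@ex_derive _ _ _ _ _ _ _ (dh _ _)); rewrite !ger0_norm.
  rewrite in_itv /= => /andP[s0 s1] E; exists s; first by rewrite !ger0_norm.
  by move: E; rewrite /h scale0r addr0 subr0 mulrC.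
have [||s] := @MVT_segment R h (fun s => 'D_v g (x + s *: v)) t 0 (ltW t0).
- move=> s; rewrite in_itv /= => /andP[s0 s1]; apply: dh.
  by rewrite !ltr0_norm // lerN2 ltW.
- apply: derivable_within_continuous => s; rewrite in_itv /= => /andP[s0 s1].
  by apply: (@ex_derive _ _ _ _ _ _ _ (dh _ _)); rewrite !ler0_norm ?lerN2 // ltW.
rewrite in_itv /= => /andP[s0 s1] E; exists s.
  by rewrite !ler0_norm ?lerN2 // ltW.
move: E; rewrite /h scale0r addr0 sub0r mulrN => /(congr1 -%R).
by rewrite opprB opprK mulrC.
Qed.

(** [smooth_on] provides directional derivatives only, so the increment is split into [d] coordinate
    steps with a mean value on each. The slack [d%:R * |w|] keeps the corners of this path in the
    ball where the bounds hold. *)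
Lemma partials_lipschitz g a (r C : R) z w : 0 <= C ->
  (forall i x, `|x - a| < r -> derivable g x (delta_mx ord0 i) /\
     `|'D_(delta_mx ord0 i) g x| <= C) ->
  `|z - a| + d%:R * `|w| < r -> `|g (z + w) - g z| <= d%:R * (C * `|w|).
Proof.
move=> C0 H zr.
have norm_delta i : `|delta_mx ord0 i : V| <= 1.
  by apply: le_trans (normr_le_eucl _) _; rewrite eucl_norm_delta.
pose zs (s : seq 'I_d) := z + \sum_(i <- s) w ord0 i *: delta_mx ord0 i.
have zsz s : `|zs s - z| <= (size s)%:R * `|w|.
  rewrite /zs addrAC subrr add0r; elim: s => [|i s IH].
    by rewrite big_nil normr0 mul0r.
  rewrite big_cons; apply: le_trans (ler_normD _ _) _.
  rewrite /= -natr1 mulrDl mul1r addrC lerD // normrZ -[leRHS]mulr1.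
  by apply: ler_pM => //; exact: coord_le_normr.
have main s : (size s <= d)%N -> `|g (zs s) - g z| <= (size s)%:R * (C * `|w|).
  elim: s => [|i s IH] /= sd.
    by rewrite /zs big_nil addr0 subrr normr0 mul0r.
  have zsE : zs (i :: s) = zs s + w ord0 i *: delta_mx ord0 i.
    by rewrite /zs big_cons -addrA; congr (_ + _); rewrite addrC.
  have inb (t : R) : `|t| <= `|w ord0 i| -> `|zs s + t *: delta_mx ord0 i - a| < r.
    move=> tw; apply: le_lt_trans zr.
    have -> : zs s + t *: delta_mx ord0 i - a =
       (z - a) + ((zs s - z) + t *: delta_mx ord0 i).
      by rewrite [RHS]addrA [z - a + _]addrC addrA subrK addrAC.
    apply: le_trans (ler_normD _ _) _; rewrite lerD2l.
    apply: le_trans (ler_normD _ _) _.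
    apply: (@le_trans _ _ ((size s)%:R * `|w| + `|w|)).
      apply: lerD => //; rewrite normrZ -[leRHS]mulr1.
      apply: ler_pM => //; exact: le_trans tw (coord_le_normr _ _).
    by rewrite -[X in _ + X]mul1r -mulrDl natr1 ler_wpM2r // ler_nat.
  have [|t tw E] := @line_mean_value g (zs s) (delta_mx ord0 i) (w ord0 i).
    by move=> t tw; have [] := H i _ (inb _ tw).
  have [_ bd] := H i _ (inb _ tw).
  rewrite zsE -(subrK (g (zs s)) (g (zs s + _))) -addrA.
  apply: le_trans (ler_normD _ _) _.
  rewrite -natr1 mulrDl mul1r [leLHS]addrC lerD //; first by apply: IH; exact: ltnW.
  by rewrite E normrM mulrC; apply: ler_pM => //; exact: coord_le_normr.
have := main (index_enum 'I_d).
have -> : size (index_enum 'I_d) = d.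
  by rewrite -[RHS](card_ord d) cardE enumT.
move=> /(_ (leqnn _)); rewrite /zs.
by rewrite -row_sum_delta.
Qed.

(** From a point with [g <= 0], a step along [v] or [- v] lowers [g] by an amount proportional to
    [r]; the Lipschitz bound keeps [g] nonpositive on a ball of proportional radius around the new
    point. *)
Lemma boundary_inner_balls X U g x0 v : X x0 -> open U -> U x0 -> smooth_on U g ->
  'D_v g x0 != 0 -> X `&` U = [set y | U y /\ g y <= 0] ->
  exists2 e : R, 0 < e & forall x, X x -> `|x - x0| < e -> inner_balls X e x.
Proof.
move=> Xx0 oU Ux0 sg c0 XU.
pose c : R := 'D_v g x0.
have nc0 : 0 < `|c| by rewrite normr_gt0.
have /nbhs_ballP[rU /= rU0 HrU] : nbhs x0 U by exact: open_nbhs_nbhs.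
have Dcont u (eps : R) : 0 < eps -> exists2 r : R, 0 < r &
    forall x, `|x - x0| < r -> `|'D_u g x0 - 'D_u g x| < eps.
  move=> eps0; have [+ _] := sg [:: u] x0 Ux0.
  move/(@cvgrPdist_lt _ _ _ _ (nbhs_filter x0)) => /(_ _ eps0)/nbhs_ballP[r /= r0 Hr].
  by exists r => // x xx0; apply: Hr; rewrite -ball_normE /= distrC.
have [rv rv0 Hrv] := Dcont v (`|c| / 2) (divr_gt0 nc0 (ltr0Sn R 1)).
have [re re0 [C C1 HC]] : exists2 r : R, 0 < r & exists2 C : R, 1 <= C &
    forall i x, `|x - x0| < r -> `|'D_(delta_mx ord0 i) g x| <= C.
  suff H (s : seq 'I_d) : exists2 r : R, 0 < r & exists2 C : R, 1 <= C &
    forall i x, i \in s -> `|x - x0| < r -> `|'D_(delta_mx ord0 i) g x| <= C.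
    have [r r0 [C C1 HC]] := H (enum 'I_d); exists r => //; exists C => // i x.
    by apply: HC; rewrite mem_enum.
  elim: s => [|i s [r r0 [C C1 HC]]]; first by exists 1 => //; exists 1.
  have [r' r'0 Hr'] := Dcont (delta_mx ord0 i) 1 ltr01.
  exists (Num.min r r'); first by rewrite lt_min r0.
  exists (Num.max C (`|'D_(delta_mx ord0 i) g x0| + 1)); first by rewrite le_max C1.
  move=> j x; rewrite in_cons lt_min => /orP[/eqP ->|js] /andP[xr xr']; rewrite le_max.
    apply/orP; right; rewrite -lerBlDl.
    apply: le_trans (lerB_dist _ _) _; rewrite distrC ltW //; exact: Hr'.
  by rewrite HC.
pose r1 := Num.min rU (Num.min rv re).
have r10 : 0 < r1 by rewrite !lt_min rU0 rv0.
pose n1 := `|v| + 1.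
have n10 : 0 < n1 by rewrite ltr_wpDl.
(* Over a distance [k * r], [g] grows by at most [d * C * (k * r)], which stays below
   [r / n1 * (|c| / 2)], the guaranteed decrease along the step. *)
pose k := Num.min 1 (`|c| / (2 * n1 * (d%:R * C + 1))).
have dC0 : 0 < d%:R * C + 1 by rewrite ltr_wpDl // mulr_ge0 // (le_trans ler01).
have k0 : 0 < k by rewrite lt_min ltr01 divr_gt0 // !mulr_gt0.
have k1 : k <= 1 by rewrite ge_min lexx.
have d10 : 0 < d%:R + 1 :> R by rewrite ltr_wpDl.
(* The second bound keeps every point considered, coordinate paths included, within [r1] of [x0],
   where all derivative estimates are valid. *)
pose e := Num.min k (r1 / (4 * (d%:R + 1))).
have e0 : 0 < e by rewrite lt_min k0 divr_gt0 // mulr_gt0.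
have ek : e <= k by rewrite ge_min lexx.
have er1 : (d%:R + 1) * (4 * e) <= r1.
  have -> : (d%:R + 1) * (4 * e) = e * (4 * (d%:R + 1)) by ring.
  by rewrite -ler_pdivlMr ?mulr_gt0 // ge_min lexx orbT.
have er1' : 4 * e <= r1.
  by apply: le_trans er1; rewrite ler_peMl ?lerDr // mulr_ge0 // ltW.
exists e => // x Xx xx0 r /andP[r0 re'].
have inU y : `|y - x0| < r1 -> U y.
  rewrite !lt_min => /andP[yU _]; apply: HrU.
  by rewrite -ball_normE /= distrC.
have gder y u : `|y - x0| < r1 -> derivable g y u.
  by move=> /inU Uy; have [_ /(_ u)] := sg [::] y Uy.
(* The sign makes [g] decrease; dividing by [n1 > |v|] makes the displacement at most [r]. *)
pose t : R := - Num.sg c * (r / n1).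
have rn0 : 0 < r / n1 by rewrite divr_gt0.
have nt : `|t| = r / n1 by rewrite normrM normrN normr_sg -/c c0 mul1r gtr0_norm.
have tv (s : R) : `|s| <= `|t| -> `|s *: v| <= r.
  move=> st; have st' : `|s| <= r / n1 by rewrite -nt.
  rewrite normrZ; apply: (@le_trans _ _ (r / n1 * n1)).
    by apply: ler_pM => //; rewrite lerDl.
  by rewrite divfK // gt_eqF.
have near_x (s : R) : `|s| <= `|t| -> `|x + s *: v - x0| < 2 * e.
  move=> /tv sv; rewrite addrAC; apply: le_lt_trans (ler_normD _ _) _.
  have := le_trans sv re'; move: xx0; lra.
exists (x + t *: v); split; first by rewrite addrAC subrr add0r tv.
move=> y yz.
have ke_r : e * r <= e by rewrite ler_piMr ?(ltW e0) //; apply: le_trans re' (le_trans ek k1).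
pose w := y - (x + t *: v).
have yE : y = x + t *: v + w by rewrite /w addrC subrK.
have we : `|w| < e by apply: lt_le_trans yz ke_r.
have Uy : U y.
  apply: inU; apply: lt_le_trans er1'.
  rewrite yE addrAC; apply: le_lt_trans (ler_normD _ _) _.
  have := near_x t (lexx _); move: we; lra.
suff gy : g y <= 0.
  have : (X `&` U) y by rewrite XU.
  by case.
have gx : g x <= 0.
  have : (X `&` U) x.
    split=> //; apply: inU; apply: lt_le_trans er1'.
    by move: xx0 e0; lra.
  by rewrite XU => -[].
have [|s st Es] := @line_mean_value g x v t.
  move=> s st; apply: gder; apply: lt_le_trans (near_x s st) _.
  by apply: le_trans er1'; move: e0; lra.
have Dv : t * 'D_v g (x + s *: v) <= - (r / n1 * (`|c| / 2)).
  have : `|c - 'D_v g (x + s *: v)| < `|c| / 2.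
    apply: Hrv; apply: (@lt_le_trans _ _ r1).
      by apply: lt_le_trans (near_x s st) _; apply: le_trans er1'; move: e0; lra.
    by rewrite !ge_min lexx orbT.
  set D := 'D_v g _ => cD.
  have sD : `|c| / 2 <= Num.sg c * D.
    have -> : Num.sg c * D = `|c| - Num.sg c * (c - D).
      by rewrite mulrBr -normrEsg opprB addrC subrK.
    have : `|Num.sg c * (c - D)| < `|c| / 2 by rewrite normrM normr_sg -/c c0 mul1r.
    by move=> /(le_lt_trans (ler_norm _)); lra.
  by rewrite /t mulNr mulNr lerN2 [leRHS]mulrAC [leRHS]mulrC ler_pM2l.
have lip : `|g (x + t *: v + w) - g (x + t *: v)| <= d%:R * (C * `|w|).
  apply: (@partials_lipschitz g x0 r1) => //; first exact: le_trans C1.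
    move=> i a ar; split; first exact: gder.
    by apply: HC; apply: lt_le_trans ar _; rewrite !ge_min lexx !orbT.
  have h := near_x t (lexx _); apply: lt_le_trans er1.
  have : d%:R * `|w| <= d%:R * e by rewrite ler_wpM2l // ltW.
  have : 0 <= d%:R * e by rewrite mulr_ge0 // ltW.
  by move: h e0; lra.
have kr : d%:R * (C * `|w|) <= r / n1 * (`|c| / 2).
  have wk : `|w| <= k * r by apply: le_trans (ltW yz) _; rewrite ler_pM2r.
  apply: (@le_trans _ _ ((d%:R * C + 1) * (k * r))).
    by rewrite mulrA; apply: ler_pM => //; rewrite ?mulr_ge0 ?lerDl // (le_trans ler01).
  have kk : k * (2 * n1 * (d%:R * C + 1)) <= `|c|.
    by rewrite -ler_pdivlMr ?ge_min ?lexx ?orbT // !mulr_gt0.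
  rewrite [leRHS]mulrAC ler_pdivlMr // -subr_ge0.
  have -> : r * (`|c| / 2) - (d%:R * C + 1) * (k * r) * n1 =
     r / 2 * (`|c| - k * (2 * n1 * (d%:R * C + 1))) by field.
  by rewrite mulr_ge0 ?subr_ge0 // divr_ge0 // ltW.
have := le_trans (ler_norm _) lip; rewrite -yE => h1.
move: Es Dv h1 kr gx; set T := t * _; lra.
Qed.

Lemma good_domain_inner_balls X : good_domain X ->
  exists2 e : R, 0 < e & forall x, X x -> inner_balls X e x.
Proof.
move=> [cX clX [vX|sX]]; first exact: convex_inner_balls.
apply: compact_uniform_gt0 => //; first exact: inner_balls_mono.
move=> x0 Xx0; have [ix0|nix0] := pselect (interior X x0).
  have /nbhs_ballP[r /= r0 Hr] : nbhs x0 X by exact: ix0.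
  exists (Num.min 1 (r / 2)); first by rewrite lt_min ltr01 divr_gt0.
  move=> x Xx; rewrite lt_min => /andP[_ xx0] s /andP[s0]; rewrite le_min => /andP[s1 sr].
  exists x; rewrite subrr normr0; split; first exact: ltW.
  move=> y yx; apply: Hr; rewrite -ball_normE /= distrC -(subrK x y) -addrA.
  apply: le_lt_trans (ler_normD _ _) _; rewrite [ltRHS](splitr r).
  apply: ltrD => //; apply: lt_le_trans yx _; apply: le_trans sr.
  by rewrite ler_piMl ?(ltW s0) // ge_min lexx.
have [U [g [oU Ux0 sg [v Dv] XU]]] := sX x0 (subset_closure Xx0) nix0.
exact: (boundary_inner_balls Xx0 oU Ux0 sg Dv XU).
Qed.

End InteriorBalls.

(** * Mass of words hitting a ball *)

Section Words.
Variable N : nat -> nat.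

(* Words are read from level [k] on: the letter at position [j] is below [N (k + j)]. *)
Fixpoint valid (k : nat) (w : seq nat) : bool :=
  if w is a :: w' then (a < N k)%N && valid k.+1 w' else true.

Fixpoint words (k n : nat) : seq (seq nat) :=
  if n is n'.+1 then [seq a :: w | a <- iota 0 (N k), w <- words k.+1 n']
  else [:: [::]].

Lemma wordsS k n :
  words k n.+1 = [seq a :: w | a <- iota 0 (N k), w <- words k.+1 n].
Proof. by []. Qed.

Lemma mem_words k n w : (w \in words k n) = valid k w && (size w == n).
Proof.
elim: n k w => [|n IH] k [|a w] //=; first by rewrite andbF.
  by apply/allpairsP => -[[b v]] [].
rewrite eqSS; apply/allpairsP/idP => [[[b v] /= [bN vw [-> ->]]]|].
  by move: vw bN; rewrite IH mem_iota add0n /= => /andP[-> ->] ->.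
move=> /andP[/andP[aN vw] sw]; exists (a, w); split => //=.
  by rewrite mem_iota.
by rewrite IH vw.
Qed.

Lemma uniq_words k n : uniq (words k n).
Proof.
elim: n k => [|n IH] k //=; apply: allpairs_uniq => //; first exact: iota_uniq.
by move=> [a v] [b w] _ _ /= [-> ->].
Qed.

Lemma valid_cat k u v : valid k (u ++ v) = valid k u && valid (k + size u) v.
Proof.
elim: u k => [|a u IH] k /=; first by rewrite addn0.
by rewrite IH andbA addSnnS.
Qed.

Lemma valid_rcons k u a : valid k (rcons u a) = valid k u && (a < N (k + size u))%N.
Proof. by rewrite -cats1 valid_cat /= andbT. Qed.

Lemma valid_take k i w : valid k w -> valid k (take i w).
Proof. by rewrite -{1}(cat_take_drop i w) valid_cat => /andP[]. Qed.

Lemma sum_words_cat (V : nmodType) k m n (F : seq nat -> V) :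
  \sum_(w <- words k (m + n)) F w =
  \sum_(u <- words k m) \sum_(v <- words (k + m) n) F (u ++ v).
Proof.
elim: m k F => [|m IH] k F; first by rewrite /= big_seq1 addn0.
rewrite addSn !wordsS !big_allpairs_dep; apply: eq_bigr => a _.
by rewrite IH addSnnS.
Qed.

Lemma sum_words1 (V : nmodType) k (F : seq nat -> V) :
  \sum_(w <- words k 1) F w = \sum_(a <- iota 0 (N k)) F [:: a].
Proof. by rewrite wordsS big_allpairs_dep; apply: eq_bigr => a _; rewrite big_seq1. Qed.

End Words.

Lemma powR_le1D (R : realType) (u a : R) : 0 <= u -> 0 <= a <= 1 -> u `^ a <= 1 + u.
Proof.
move=> u0 /andP[a0 a1]; have [u1|u1] := leP u 1.
  apply: (@le_trans _ _ 1); last by rewrite lerDl.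
  have <- : 1 `^ a = 1 :> R by rewrite powR1.
  by apply: ge0_ler_powR => //; rewrite nnegrE.
apply: (@le_trans _ _ u); last by rewrite lerDr.
by rewrite -[leRHS]powRr1 // ler_powR // ltW.
Qed.

(** * Weights of words for an abstract quasi-multiplicative size [S] *)

Section WordMass.
Variables (R : realType) (N : nat -> nat) (S : nat -> seq nat -> R).
Variables (K eta t : R) (d : nat).
Hypotheses (K1 : 1 <= K) (eta0 : 0 < eta) (eta1 : eta < 1) (d0 : (0 < d)%N) (t0 : 0 <= t).
Hypothesis N0 : forall k, (0 < N k)%N.
Hypothesis S_nil : forall k, S k [::] = 1.
Hypothesis S_gt0 : forall k w, valid N k w -> 0 < S k w.
Hypothesis S_submul : forall k u v, valid N k (u ++ v) ->
  S k (u ++ v) <= S k u * S (k + size u) v.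
Hypothesis S_supmul : forall k u v, valid N k (u ++ v) ->
  S k u * S (k + size u) v <= K * S k (u ++ v).
Hypothesis S_eta : forall k a, (a < N k)%N -> S k [:: a] <= eta.

Let K0 : 0 < K := lt_le_trans ltr01 K1.

(** For [k = 0] this is the partition function of the theorem; other starting levels are needed for
    the tails left after a cut. *)
Definition Zw k n (s : R) := \sum_(w <- words N k n) S k w `^ s.

Lemma S_ge0 k w : valid N k w -> 0 <= S k w.
Proof. by move=> /S_gt0/ltW. Qed.

Lemma S_le_etaX k w : valid N k w -> S k w <= eta ^+ size w.
Proof.
elim: w k => [|a w IH] k /=; first by rewrite S_nil.
move=> /andP[aN vw]; have := @S_submul k [:: a] w; rewrite /= aN => /(_ vw) h.
apply: le_trans h _; rewrite exprS addn1.
by apply: ler_pM; rewrite ?S_eta ?IH ?ltW ?S_gt0 //= aN.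
Qed.

Lemma S_le1 k w : valid N k w -> S k w <= 1.
Proof.
move=> vw; apply: le_trans (S_le_etaX vw) _.
by apply: exprn_ile1; rewrite ltW.
Qed.

Lemma S_le_prefix k u v : valid N k (u ++ v) -> S k (u ++ v) <= S k u.
Proof.
move=> vuv; apply: le_trans (S_submul vuv) _.
move: vuv; rewrite valid_cat => /andP[vu vv].
by rewrite ler_piMr ?S_le1 // ltW // S_gt0.
Qed.

Lemma Zw_ge0 k n s : 0 <= Zw k n s.
Proof. by apply: sumr_ge0 => w _; exact: powR_ge0. Qed.

Lemma words_neq0 k n : exists w, w \in words N k n.
Proof.
elim: n k => [|n IH] k; first by exists [::].
have [w ww] := IH k.+1; exists (0%N :: w).
by move: ww; rewrite !mem_words /= eqSS N0.
Qed.

Lemma Zw_gt0 k n s : 0 < Zw k n s.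
Proof.
have [w ww] := words_neq0 k n.
rewrite /Zw (big_rem _ ww) /= ltr_pwDl //.
  by apply: powR_gt0; apply: S_gt0; move: ww; rewrite mem_words => /andP[].
by apply: sumr_ge0 => v _; exact: powR_ge0.
Qed.

(** Bounded distortion, raised to the power [t] and summed over both factors of the word. *)
Lemma Zw_supmul k m n :
  Zw k m t * Zw (k + m) n t <= K `^ t * Zw k (m + n) t.
Proof.
rewrite /Zw sum_words_cat mulr_suml mulr_sumr big_seq [leRHS]big_seq.
apply: ler_sum => u; rewrite mem_words => /andP[vu /eqP su].
rewrite mulr_sumr mulr_sumr big_seq [leRHS]big_seq; apply: ler_sum => v.
rewrite mem_words => /andP[vv _].
have vuv : valid N k (u ++ v) by rewrite valid_cat vu su.
have := S_supmul vuv; rewrite su => h.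
rewrite -!powRM ?S_ge0 ?(ltW K0) //.
by apply: ge0_ler_powR; rewrite ?nnegrE ?mulr_ge0 ?S_ge0 ?(ltW K0).
Qed.

Lemma Zw1_ge k c : 0 <= c -> (forall a, (a < N k)%N -> c <= S k [:: a]) ->
  (N k)%:R * c `^ t <= Zw k 1 t.
Proof.
move=> c0 H; rewrite /Zw sum_words1.
have -> : (N k)%:R * c `^ t = \sum_(a <- iota 0 (N k)) c `^ t.
  by rewrite big_const_seq count_predT size_iota iter_addr_0 mulr_natl.
rewrite big_seq [leRHS]big_seq; apply: ler_sum => a; rewrite mem_iota add0n => /andP[_ aN].
by apply: ge0_ler_powR; rewrite ?nnegrE // ?H // ltW // S_gt0 //= aN.
Qed.

(** Converts the tail sum into [Zw 0 n t] divided by the level [i] factors. The two powers of [K]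
    come from detaching the first [i] letters and then the single letter at level [i]. *)
Lemma Zw_split_ge i m c : 0 <= c -> (forall a, (a < N i)%N -> c <= S i [:: a]) ->
  Zw 0 i t * ((N i)%:R * c `^ t) * Zw i.+1 m t <= (K `^ t) ^+ 2 * Zw 0 (i + m.+1) t.
Proof.
move=> c0 H; rewrite -mulrA.
apply: (@le_trans _ _ (Zw 0 i t * (K `^ t * Zw i m.+1 t))).
  rewrite ler_wpM2l ?Zw_ge0 //.
  apply: le_trans (_ : Zw i 1 t * Zw i.+1 m t <= _).
    by rewrite ler_wpM2r ?Zw_ge0 // Zw1_ge.
  by have := Zw_supmul i 1 m; rewrite addn1 add1n.
rewrite mulrCA expr2 -mulrA ler_wpM2l ?powR_ge0 //.
exact: (Zw_supmul 0 i m.+1).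
Qed.

Lemma Zw_ext_le k u m : valid N k u ->
  \sum_(v <- words N (k + size u) m) S k (u ++ v) `^ t
    <= S k u `^ t * Zw (k + size u) m t.
Proof.
move=> vu; rewrite /Zw mulr_sumr big_seq [leRHS]big_seq; apply: ler_sum => v.
rewrite mem_words => /andP[vv _].
have vuv : valid N k (u ++ v) by rewrite valid_cat vu.
rewrite -powRM ?S_ge0 //.
by apply: ge0_ler_powR; rewrite ?nnegrE ?mulr_ge0 ?S_submul ?S_ge0.
Qed.

(** Prefix-incomparable words: under the open set condition the corresponding images of the interior
    of [X] are disjoint. *)
Definition antichain (L : seq (seq nat)) :=
  forall u v, u \in L -> v \in L -> prefix u v -> u = v.

Lemma antichain_same_size L n : {in L, forall u, size u = n} -> antichain L.
Proof.
move=> H u v uL vL /prefixP[s E].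
have := H _ vL; rewrite E size_cat H // => /eqP.
by rewrite -[X in _ == X]addn0 eqn_add2l size_eq0 => /eqP ->; rewrite cats0.
Qed.

(** * Words hitting one fixed ball of radius [r], with the geometry abstracted into [hit] and
    [packing] *)

Section Ball.
Variables (hit : pred (seq nat)) (r C : R) (n : nat).
Hypothesis hit_prefix : forall u v, valid N 0 (u ++ v) -> hit (u ++ v) -> hit u.
Hypotheses (r0 : 0 < r) (r1 : r < 1) (C0 : 0 <= C).
Hypothesis packing : forall L, uniq L -> antichain L ->
  {in L, forall w, valid N 0 w && hit w} ->
  \sum_(w <- L) Num.min (S 0 w) r ^+ d <= C * r ^+ d.
Hypothesis small_n : forall w, w \in words N 0 n -> S 0 w <= r.

Let small w := S 0 w <= r.
Let bighit w := ~~ small w && hit w.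
Let smallhit w := small w && hit w.
(** Possible places of a cut. The small child is not asked to hit the ball, as the length of a chain
    of parents is estimated from sizes alone. *)
Let parent w := bighit w && has (fun a => small (rcons w a)) (iota 0 (N (size w))).

Lemma bighit_prefix u v : valid N 0 (u ++ v) -> bighit (u ++ v) -> bighit u.
Proof.
move=> vuv /andP[big_uv hit_uv]; rewrite /bighit (hit_prefix vuv hit_uv) andbT.
by apply: contra big_uv; exact: le_trans (S_le_prefix vuv).
Qed.

Lemma first_small w : w \in words N 0 n -> hit w ->
  exists i : 'I_n, bighit (take i w) && smallhit (take i.+1 w).
Proof.
move=> ww hw; have := ww; rewrite mem_words => /andP[vw /eqP sw].
have hitt i : hit (take i w).
  by apply: (@hit_prefix _ (drop i w)); rewrite cat_take_drop.
have ex : exists i, small (take i w).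
  by exists n; rewrite -sw take_size; exact: small_n.
(* The shortest small prefix is nonempty because the empty word has size [1 > r]; so it has an
   immediate predecessor, which is big by minimality. *)
case: (ex_minnP ex) => -[|i] si mini.
  by move: si; rewrite take0 /small S_nil leNgt r1.
have iln : (i < n)%N.
  rewrite ltnNge; apply/negP => ni.
  suff : (i < i)%N by rewrite ltnn.
  by apply: mini; move: si; rewrite !take_oversize ?sw // leqW.
exists (Ordinal iln); rewrite /bighit /smallhit !hitt si !andbT /=.
by apply/negP => /mini; rewrite ltnn.
Qed.

(** Each hitting word is written as [rcons u a ++ v] at a cut. Only the existence of a cut is used;
    nonnegativity of [F] makes any repetition harmless. *)
Lemma sum_hit_le (F : seq nat -> R) : (forall w, 0 <= F w) ->
  \sum_(w <- words N 0 n | hit w) F w <=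
  \sum_(i < n) \sum_(u <- words N 0 i | bighit u)
    \sum_(a <- iota 0 (N i) | smallhit (rcons u a))
      \sum_(v <- words N i.+1 (n - i.+1)) F (rcons u a ++ v).
Proof.
move=> F0.
have -> : \sum_(i < n) \sum_(u <- words N 0 i | bighit u)
    \sum_(a <- iota 0 (N i) | smallhit (rcons u a))
      \sum_(v <- words N i.+1 (n - i.+1)) F (rcons u a ++ v) =
    \sum_(w <- words N 0 n) \sum_(i < n)
      (if bighit (take i w) && smallhit (take i.+1 w) then F w else 0).
  rewrite [RHS]exchange_big; apply: eq_bigr => i _.
  have -> : words N 0 n = words N 0 (i + (1 + (n - i.+1))).
    by rewrite add1n -subSn ?ltn_ord // subSS subnKC // ltnW // ltn_ord.
  rewrite sum_words_cat big_mkcond big_seq [RHS]big_seq; apply: eq_bigr => u.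
  rewrite mem_words => /andP[vu /eqP su].
  rewrite sum_words_cat sum_words1 add0n addn1.
  have tk a v : take i (u ++ [:: a] ++ v) = u by rewrite -su take_size_cat.
  have tk1 a v : take i.+1 (u ++ [:: a] ++ v) = rcons u a.
    by rewrite catA cats1 take_size_cat // size_rcons su.
  case: ifP => bu; last first.
    by rewrite big1 // => a _; rewrite big1 // => v _; rewrite tk bu.
  rewrite big_mkcond; apply: eq_bigr => a _.
  case: ifP => sa; last by rewrite big1 // => v _; rewrite tk1 sa andbF.
  by apply: eq_bigr => v _; rewrite tk tk1 bu sa catA cats1.
rewrite big_mkcond big_seq [leRHS]big_seq; apply: ler_sum => w ww.
case: ifP => hw; last by apply: sumr_ge0 => i _; case: ifP.
have [i Hi] := first_small ww hw.
by rewrite (bigD1 i) //= Hi lerDl; apply: sumr_ge0 => j _; case: ifP.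
Qed.

(* With [A = r^d / N i], each [S^t = (S^d)^(t/d)] is at most [A^(t/d) (1 + S^d / A)],
   which replaces Hoelder's inequality. *)
Lemma small_children_le i u : t <= d%:R -> u \in words N 0 i ->
  \sum_(a <- iota 0 (N i) | smallhit (rcons u a)) S 0 (rcons u a) `^ t
  <= (1 + C) * r `^ t * ((N i)%:R / (N i)%:R `^ (t / d%:R)).
Proof.
move=> td uw; have := uw; rewrite mem_words => /andP[vu /eqP su].
have dR0 : 0 < d%:R :> R by rewrite ltr0n.
pose al := t / d%:R.
have al01 : 0 <= al <= 1 by rewrite divr_ge0 //= ler_pdivrMr // mul1r.
have NR0 : 0 < (N i)%:R :> R by rewrite ltr0n.
pose A := r ^+ d / (N i)%:R.
have rd0 : 0 < r ^+ d by rewrite exprn_gt0.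
have A0 : 0 < A by rewrite divr_gt0.
pose I := [seq a <- iota 0 (N i) | smallhit (rcons u a)].
have vI a : a \in I -> valid N 0 (rcons u a) && smallhit (rcons u a).
  rewrite mem_filter mem_iota add0n => /andP[sa /andP[_ aN]].
  by rewrite valid_rcons vu add0n su aN.
have rconsI : injective (rcons u) := rcons_injr u.
have pk : \sum_(a <- I) S 0 (rcons u a) ^+ d <= C * r ^+ d.
  have := @packing [seq rcons u a | a <- I].
  rewrite big_map map_inj_uniq // filter_uniq ?iota_uniq // => /(_ isT) h.
  rewrite big_seq (eq_bigr (fun a => Num.min (S 0 (rcons u a)) r ^+ d)); last first.
    by move=> a /vI/and3P[_ sa _]; rewrite min_l.
  rewrite -big_seq; apply: h.
    apply: (@antichain_same_size _ i.+1) => _ /mapP[a _ ->].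
    by rewrite size_rcons su.
  by move=> _ /mapP[a /vI/and3P[v1 _ h1] ->]; rewrite v1.
rewrite -big_filter -/I.
apply: (@le_trans _ _ (\sum_(a <- I) A `^ al * (1 + A^-1 * S 0 (rcons u a) ^+ d))).
  rewrite big_seq [leRHS]big_seq; apply: ler_sum => a /vI/andP[va _].
  have Sa := S_gt0 va; set s := S 0 _ in Sa *.
  have -> : s `^ t = A `^ al * (A^-1 * s ^+ d) `^ al.
    rewrite -powRM ?(ltW A0) ?mulr_ge0 ?invr_ge0 ?exprn_ge0 ?(ltW A0) ?(ltW Sa) //.
    by rewrite mulVKf ?gt_eqF // -powR_mulrn ?(ltW Sa) // -powRrM mulrC divfK // gt_eqF.
  rewrite ler_wpM2l ?powR_ge0 //; apply: powR_le1D => //.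
  by rewrite mulr_ge0 ?invr_ge0 ?exprn_ge0 // ltW.
rewrite -mulr_sumr big_split /= -mulr_sumr.
have -> : A `^ al = r `^ t / (N i)%:R `^ al.
  rewrite /A powRM ?invr_ge0 ?(ltW rd0) ?(ltW NR0) // -powR_mulrn ?(ltW r0) // -powRrM.
  rewrite mulrC [d%:R * _]mulrC divfK ?gt_eqF // mulrC; congr (_ * _).
  by rewrite -[in LHS]powR_inv1 ?(ltW NR0) // -powRrM mulN1r powRN.
have s1 : \sum_(a <- I) (1 : R) <= (N i)%:R.
  rewrite big_const_seq count_predT iter_addr_0 ler_nat size_filter.
  by rewrite (leq_trans (count_size _ _)) // size_iota.
have s2 : A^-1 * \sum_(a <- I) S 0 (rcons u a) ^+ d <= C * (N i)%:R.
  apply: (@le_trans _ _ (A^-1 * (C * r ^+ d))).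
    by rewrite ler_wpM2l // invr_ge0 ltW.
  by rewrite /A invf_div mulrCA divfK // gt_eqF.
have -> : (1 + C) * r `^ t * ((N i)%:R / (N i)%:R `^ al) =
  r `^ t / (N i)%:R `^ al * ((N i)%:R + C * (N i)%:R) by ring.
by rewrite ler_wpM2l ?lerD // divr_ge0 // powR_ge0.
Qed.

(** The children contribute [N i] to the power [1 - t/d], and the tail contributes the inverse of
    [Zw 0 i t * (N i * c^t)]; the powers of [N i] combine into the single [t/d] of [Ztilde]. *)
Lemma parent_mass_le i u c : t <= d%:R -> (i < n)%N -> 0 < c ->
  (forall a, (a < N i)%N -> c <= S i [:: a]) -> u \in words N 0 i ->
  \sum_(a <- iota 0 (N i) | smallhit (rcons u a))
    \sum_(v <- words N i.+1 (n - i.+1)) S 0 (rcons u a ++ v) `^ t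
  <= (1 + C) * (K `^ t) ^+ 2 * r `^ t * Zw 0 n t *
     (Zw 0 i t * (N i)%:R `^ (t / d%:R) * c `^ t)^-1.
Proof.
move=> td iln c0 Hc uw; have := uw; rewrite mem_words => /andP[vu /eqP su].
set Zr := Zw i.+1 (n - i.+1) t.
apply: (@le_trans _ _ ((\sum_(a <- iota 0 (N i) | smallhit (rcons u a))
    S 0 (rcons u a) `^ t) * Zr)).
  rewrite mulr_suml big_seq_cond [leRHS]big_seq_cond; apply: ler_sum => a.
  rewrite mem_iota add0n => /andP[/andP[_ aN] _].
  have va : valid N 0 (rcons u a) by rewrite valid_rcons vu add0n su.
  by have := Zw_ext_le (n - i.+1) va; rewrite size_rcons su add0n.
apply: (@le_trans _ _ ((1 + C) * r `^ t * ((N i)%:R / (N i)%:R `^ (t / d%:R)) * Zr)).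
  by rewrite ler_wpM2r ?Zw_ge0 // small_children_le.
have h : Zw 0 i t * ((N i)%:R * c `^ t) * Zr <= (K `^ t) ^+ 2 * Zw 0 n t.
  have nE : (i + (n - i.+1).+1 = n)%N by rewrite subnSK // subnKC // ltnW.
  by have := Zw_split_ge (n - i.+1) (ltW c0) Hc; rewrite nE.
have NR0 : 0 < (N i)%:R :> R by rewrite ltr0n.
set Na := (N i)%:R `^ (t / d%:R).
have Na0 : 0 < Na by rewrite powR_gt0.
have Zi0 : 0 < Zw 0 i t by exact: Zw_gt0.
have ct0 : 0 < c `^ t by rewrite powR_gt0.
rewrite ler_pdivlMr ?mulr_gt0 //.
have -> : (1 + C) * r `^ t * ((N i)%:R / Na) * Zr * (Zw 0 i t * Na * c `^ t) =
  ((1 + C) * r `^ t) * (Zw 0 i t * ((N i)%:R * c `^ t) * Zr).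
  by field; rewrite gt_eqF.
have -> : (1 + C) * K `^ t ^+ 2 * r `^ t * Zw 0 n t =
  ((1 + C) * r `^ t) * (K `^ t ^+ 2 * Zw 0 n t) by ring.
by rewrite ler_wpM2l // mulr_ge0 ?powR_ge0 // addr_ge0.
Qed.

Let W := flatten [seq words N 0 i | i <- iota 0 n].
Let leaves := [seq w <- W | bighit w &&
  all (fun a => ~~ bighit (rcons w a)) (iota 0 (N (size w)))].

Lemma mem_W w : (w \in W) = valid N 0 w && (size w < n)%N.
Proof.
apply/flattenP/idP => [[s /mapP[i]]|/andP[vw sw]].
  by rewrite mem_iota add0n => /andP[_ iln] ->; rewrite mem_words => /andP[-> /eqP ->].
exists (words N 0 (size w)); last by rewrite mem_words vw eqxx.
by apply/mapP; exists (size w) => //; rewrite mem_iota.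
Qed.

Lemma uniq_W : uniq W.
Proof.
have H m k : uniq (flatten [seq words N 0 i | i <- iota k m]); last exact: H.
elim: m k => [|m IH] k //=.
rewrite cat_uniq uniq_words IH andbT /=; apply/hasPn => w /flattenP[s /mapP[i]].
rewrite mem_iota => /andP[ki _] -> ; rewrite !mem_words => /andP[_ /eqP si].
by rewrite si; apply/negP => /andP[_ /eqP ik]; rewrite ik ltnn in ki.
Qed.

(** A word of length at least [n] has a small prefix of length [n], hence is small itself. This
    makes the tree of big hitting words finite. *)
Lemma bighit_size w : valid N 0 w -> bighit w -> (size w < n)%N.
Proof.
move=> vw /andP[bw _]; rewrite ltnNge; apply/negP => nw.
move/negP: bw; apply; rewrite -(cat_take_drop n w) in vw *.
apply: le_trans (S_le_prefix vw) _; apply: small_n.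
move: vw; rewrite valid_cat mem_words => /andP[-> _] /=.
by rewrite size_takel.
Qed.

Lemma leaf_ext u : valid N 0 u -> bighit u -> exists2 w, w \in leaves & prefix u w.
Proof.
move: {2}(n - size u)%N (leqnn (n - size u)) => m.
elim: m u => [|m IH] u um vu bu; have su := bighit_size vu bu.
  by move: um; rewrite leqn0 subn_eq0 leqNgt su.
have [lf|] := boolP (all (fun a => ~~ bighit (rcons u a)) (iota 0 (N (size u)))).
  by exists u; rewrite ?prefix_refl // mem_filter bu lf mem_W vu su.
move=> /allPn[a]; rewrite mem_iota add0n => /andP[_ aN] /negPn ba.
have va : valid N 0 (rcons u a) by rewrite valid_rcons vu.
have [|w wl pw] := IH _ _ va ba; first by rewrite size_rcons subnS; case: (n - _)%N um.
exists w => //; apply: prefix_trans pw; exact: prefix_rcons.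
Qed.

Lemma leaves_antichain : antichain leaves.
Proof.
move=> u v; rewrite !mem_filter !mem_W => /andP[/andP[bu /allP lu] /andP[vu su]].
move=> /andP[/andP[bv _] /andP[vv sv]] /prefixP[[|a s] E]; first by rewrite E cats0.
rewrite E -cat_rcons in vv bv.
have := bighit_prefix vv bv; move: vv; rewrite valid_cat valid_rcons => /andP[/andP[_ aN] _].
by move=> ba; have := lu a; rewrite mem_iota aN ba => /(_ isT).
Qed.

(** A leaf is big, so its term in the packing sum is the full [r ^+ d]; these factors cancel and a
    pure count remains. *)
Lemma size_leaves : (size leaves)%:R <= C.
Proof.
have rd0 : 0 < r ^+ d by rewrite exprn_gt0.
rewrite -(ler_pM2r rd0).
have H : {in leaves, forall w, valid N 0 w && bighit w}.
  by move=> w; rewrite mem_filter mem_W => /andP[/andP[-> _] /andP[->]].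
have := @packing leaves (filter_uniq _ uniq_W) leaves_antichain.
have Hh : {in leaves, forall w, valid N 0 w && hit w}.
  by move=> w /H/and3P[-> _ ->].
move=> /(_ Hh); apply: le_trans.
have -> : (size leaves)%:R * r ^+ d = \sum_(w <- leaves) r ^+ d.
  by rewrite big_const_seq count_predT iter_addr_0 mulr_natl.
rewrite big_seq [leRHS]big_seq; apply: ler_sum => w /H/and3P[_ bw _].
rewrite min_r // ltW // ltNge; exact: bw.
Qed.

Variables (Rk cm : nat -> R) (c0 : R) (k0 : nat).
Hypotheses (Rk1 : forall i, 1 <= Rk i) (Rk_mono : forall i j, (i <= j)%N -> Rk i <= Rk j).
Hypothesis S_ratio : forall i a b, (a < N i)%N -> (b < N i)%N ->
  S i [:: a] <= Rk i * S i [:: b].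
Hypothesis cm_gt0 : forall i, 0 < cm i.
Hypothesis cm_le : forall i a, (a < N i)%N -> cm i <= S i [:: a].
Hypothesis big_k0 : forall w, valid N 0 w -> (size w <= k0)%N -> r < S 0 w.
Hypothesis c0_gt0 : 0 < c0.
Hypothesis Zt_ge : forall i, (k0 <= i)%N ->
  c0 * (1 + ln (Rk i)) <= Zw 0 i t * (N i)%:R `^ (t / d%:R) * cm i `^ t.

(** An upper bound for the inverse of the [Ztilde] expression from level [k0] on. Depending on the
    nondecreasing [Rk] alone, it is antitone, so along a branch it is largest at the first
    parent. *)
Let g i := (c0 * (1 + ln (Rk i)))^-1.

Lemma lnRk_ge0 i : 0 <= ln (Rk i).
Proof. by rewrite ln_ge0. Qed.

Lemma g_ge0 i : 0 <= g i.
Proof. by rewrite invr_ge0 mulr_ge0 ?(ltW c0_gt0) // addr_ge0 // lnRk_ge0. Qed.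

Lemma g_mono i j : (i <= j)%N -> g j <= g i.
Proof.
move=> ij; have p k : 0 < 1 + ln (Rk k) by rewrite ltr_wpDr ?lnRk_ge0.
rewrite lef_pV2 ?posrE ?mulr_gt0 // ler_pM2l // lerD2l ler_ln ?posrE ?Rk_mono //;
  exact: lt_le_trans ltr01 (Rk1 _).
Qed.

(** A branch has at most [2 + (ln K + ln (Rk i0)) / - ln eta] parent levels; multiplied by [g i0],
    this is bounded independently of [Rk i0] by the present constant. *)
Let bchain := (2 + (ln K + 1) / - ln eta) / c0.

(* Below the first parent [take i0 w] all words are at most [Rk i0 * K * r]
   and shrink geometrically, so they stay bigger than [r] only for
   [O(1 + ln (Rk i0))] further levels. *)
Lemma chain_length w i0 i : valid N 0 w -> (i0 < i)%N -> (i <= size w)%N ->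
  parent (take i0 w) -> parent (take i w) ->
  (i - i0.+1)%:R * - ln eta <= ln K + ln (Rk i0).
Proof.
move=> vw i0i isw /andP[_ /hasP[b]] /[swap] sb /[swap] /andP[/andP[bi _] _].
have i0w : (i0 < size w)%N by exact: leq_trans isw.
rewrite mem_iota add0n size_takel ?(ltnW i0w) // => /andP[_ bN].
(* [a] is the letter the branch follows after [u], and [b] that of a small child of [u]. Passing
   from [b] to [a] costs [Rk i0], splitting the word of the small child costs [K], and every later
   letter gains a factor [eta]. *)
pose u := take i0 w; pose a := nth 0%N w i0.
have su : size u = i0 by rewrite size_takel // ltnW.
pose v := drop i0.+1 (take i w).
have tE : take i w = u ++ a :: v.
  rewrite -(cat_take_drop i0.+1 (take i w)) take_takel // (take_nth 0%N) // cat_rcons.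
  by [].
have sv : size v = (i - i0.+1)%N by rewrite size_drop size_takel.
have vt : valid N 0 (u ++ a :: v) by rewrite -tE valid_take.
have := vt; rewrite valid_cat /= su => /and3P[vu aN vv].
have Su := S_gt0 vu.
have h1 : S 0 (u ++ a :: v) <= S 0 u * (S i0 [:: a] * eta ^+ (i - i0.+1)).
  apply: le_trans (S_submul vt) _; rewrite su ler_wpM2l ?(ltW Su) //.
  have := @S_submul i0 [:: a] v; rewrite /= aN => /(_ vv) h.
  apply: le_trans h _; rewrite ler_wpM2l ?S_ge0 //= ?aN // addn1 -sv.
  exact: S_le_etaX.
have h2 : S 0 u * S i0 [:: b] <= K * r.
  have vub : valid N 0 (u ++ [:: b]) by rewrite valid_cat /= su vu bN.
  have := S_supmul vub; rewrite su => h; apply: le_trans h _.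
  by rewrite ler_pM2l // cats1.
have h3 : r < Rk i0 * (K * r) * eta ^+ (i - i0.+1).
  apply: (@lt_le_trans _ _ (S 0 (u ++ a :: v))); first by rewrite -tE ltNge.
  apply: le_trans h1 _; rewrite mulrA ler_wpM2r ?exprn_ge0 ?(ltW eta0) //.
  apply: (@le_trans _ _ (S 0 u * (Rk i0 * S i0 [:: b]))).
    by rewrite ler_pM2l // S_ratio.
  by rewrite mulrCA ler_pM2l // (lt_le_trans ltr01).
have Rk0 : 0 < Rk i0 by rewrite (lt_le_trans ltr01).
have h4 : 1 < Rk i0 * K * eta ^+ (i - i0.+1).
  by rewrite -(ltr_pM2r r0) mul1r; apply: lt_le_trans h3 _; rewrite le_eqVlt; apply/orP; left; apply/eqP; ring.
have := h4; rewrite -ltr_ln ?posrE ?mulr_gt0 ?exprn_gt0 // ln1.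
rewrite !lnM ?posrE ?mulr_gt0 ?exprn_gt0 // lnXn // -mulr_natl => h5.
by apply: ltW; move: h5; rewrite mulrN; lra.
Qed.

Lemma sum_chain_le w : valid N 0 w ->
  \sum_(i < n | parent (take i w) && (i <= size w)%N) g i <= bchain.
Proof.
move=> vw; have E0 : 0 < - ln eta by rewrite oppr_gt0 ln_lt0 // eta0.
have K1' : 0 <= ln K by rewrite ln_ge0.
have [/existsP[j /andP[Pj jw]]|/existsPn none] :=
    boolP [exists i : 'I_n, parent (take i w) && (i <= size w)%N]; last first.
  rewrite big1 => [|i Hi]; last by have := none i; rewrite Hi.
  by rewrite divr_ge0 ?(ltW c0_gt0) // addr_ge0 // divr_ge0 ?addr_ge0 // ltW.
have ex : exists i, parent (take i w) && (i <= size w)%N by exists j; rewrite Pj.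
case: (ex_minnP ex) => i0 /andP[Pi0 i0w] mini.
pose x := (ln K + ln (Rk i0)) / - ln eta.
have x0 : 0 <= x by rewrite divr_ge0 ?addr_ge0 ?lnRk_ge0 // ltW.
(* Besides [i0] itself, a parent level [i] satisfies [i - i0.+1 <= truncn x], which leaves
   [truncn x + 1] further levels. *)
pose q := (Num.truncn x).+2.
have Hq i : parent (take i w) -> (i <= size w)%N -> (i0 <= i < i0 + q)%N.
  move=> Pi iw; have i0i : (i0 <= i)%N by apply: mini; rewrite Pi.
  rewrite i0i /=; move: i0i; rewrite leq_eqVlt => /orP[/eqP <-|i0i].
    by rewrite -addSnnS leq_addr.
  have := chain_length vw i0i iw Pi0 Pi; rewrite -ler_pdivlMr // -/x => hx.
  have : (i - i0.+1 <= Num.truncn x)%N.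
    by rewrite -ltnS -(ltr_nat R); apply: le_lt_trans hx _; have /andP[] := truncn_itv x0.
  by rewrite leq_subLR addSn /q !addnS !ltnS.
apply: (@le_trans _ _ (\sum_(i < n | (i0 <= i < i0 + q)%N) g i0)).
  rewrite big_mkcond [leRHS]big_mkcond; apply: ler_sum => i _.
  case: ifP => [/andP[Pi iw]|nP].
    have := Hq _ Pi iw => /[dup] /andP[i0i _] ->; exact: g_mono.
  by case: ifP => ?; rewrite ?g_ge0.
have cnt : (#|[pred i : 'I_n | (i0 <= i < i0 + q)%N]| <= q)%N.
  rewrite -[X in (_ <= X)%N](size_iota i0) cardE -(size_map val).
  apply: uniq_leq_size; first by rewrite map_inj_uniq ?enum_uniq //; exact: val_inj.
  by move=> k /mapP[i]; rewrite mem_enum unfold_in => Hi ->; rewrite mem_iota.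
rewrite sumr_const -[leLHS]mulr_natl.
apply: (@le_trans _ _ (q%:R * g i0)); first by rewrite ler_wpM2r ?g_ge0 ?ler_nat.
have l1 : 0 < 1 + ln (Rk i0) by rewrite ltr_wpDr ?lnRk_ge0.
rewrite /g invfM mulrA mulrAC /bchain ler_pM2r ?invr_gt0 // ler_pdivrMr //.
have qx : q%:R <= 2 + x.
  by rewrite /q -addn2 natrD addrC lerD2l; have /andP[] := truncn_itv x0.
apply: le_trans qx _.
have -> : x = (ln K + ln (Rk i0)) * (- ln eta)^-1 by [].
set y := (- ln eta)^-1; have y0 : 0 < y by rewrite invr_gt0.
have := lnRk_ge0 i0; set l := ln (Rk i0) => l0; rewrite -subr_ge0.
have -> : (2 + (ln K + 1) * y) * (1 + l) - (2 + (ln K + l) * y) =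
  2 * l + y + y * ln K * l by ring.
by rewrite !addr_ge0 ?mulr_ge0 // ltW.
Qed.

(** The lower bound on [Ztilde] is available only from level [k0] on; words with at most [k0]
    letters are bigger than [r], so no cut occurs earlier. *)
Lemma parent_level u : valid N 0 u -> parent u -> (k0 <= size u)%N.
Proof.
move=> vu /andP[_ /hasP[a]]; rewrite mem_iota add0n => /andP[_ aN] sa.
have va : valid N 0 (rcons u a) by rewrite valid_rcons vu.
rewrite leqNgt; apply/negP => uk; have := big_k0 va; rewrite size_rcons => /(_ uk).
by rewrite ltNge; move: sa; rewrite /small => ->.
Qed.

(** Every parent is a prefix of some leaf, and distinct parents of one level need distinct leaves.
    The sum is thus dominated by a sum over leaves of the cost of one branch. *)
Lemma sum_parents_le :
  \sum_(i < n) \sum_(u <- words N 0 i | parent u) g i <= C * bchain.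
Proof.
apply: (@le_trans _ _ (\sum_(w <- leaves) bchain)); last first.
  rewrite big_const_seq count_predT iter_addr_0 -[leLHS]mulr_natl ler_wpM2r ?size_leaves //.
  by apply: le_trans (@sum_chain_le [::] isT); apply: sumr_ge0 => i _; exact: g_ge0.
have leafv w : w \in leaves -> valid N 0 w.
  by rewrite mem_filter mem_W => /and3P[_ ->].
apply: (@le_trans _ _ (\sum_(w <- leaves)
   \sum_(i < n | parent (take i w) && (i <= size w)%N) g i)); last first.
  by rewrite big_seq [leRHS]big_seq; apply: ler_sum => w /leafv; exact: sum_chain_le.
rewrite [leRHS](eq_bigr (fun w => \sum_(i < n)
   if parent (take i w) && (i <= size w)%N then g i else 0)); last first.
  by move=> w _; rewrite big_mkcond.
rewrite exchange_big /=; apply: ler_sum => i _.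
rewrite -big_mkcond -[leLHS]big_filter -[leRHS]big_filter.
pose A := [seq u <- words N 0 i | parent u].
pose B := [seq w <- leaves | parent (take i w) && (i <= size w)%N].
(* [take i] maps the leaves passing through a level [i] parent onto a list containing all such
   parents. *)
have AB : (size A <= size B)%N.
  have sub : {subset A <= [seq take i w | w <- B]}.
    move=> u; rewrite mem_filter mem_words => /and3P[Pu vu /eqP su].
    have [|w wl pw] := leaf_ext vu; first by case/andP: Pu.
    have tw : take i w = u by case/prefixP: pw => s ->; rewrite -su take_size_cat.
    apply/mapP; exists w => //; rewrite mem_filter wl tw Pu andbT /= -su.
    by case/prefixP: pw => s ->; rewrite size_cat leq_addr.
  by rewrite -(size_map (take i) B); apply: uniq_leq_size sub; rewrite filter_uniq // uniq_words.
rewrite -/A -/B !big_const_seq !count_predT !iter_addr_0.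
rewrite -[leLHS]mulr_natl -[leRHS]mulr_natl.
by rewrite ler_wpM2r ?g_ge0 // ler_nat.
Qed.

Lemma hit_mass_le : t <= d%:R ->
  \sum_(w <- words N 0 n | hit w) S 0 w `^ t <=
  (1 + C) * (K `^ t) ^+ 2 * (C * ((2 + (ln K + 1) / - ln eta) / c0)) * r `^ t * Zw 0 n t.
Proof.
move=> td; apply: le_trans (sum_hit_le (fun w => powR_ge0 (S 0 w) t)) _.
set c1 := (1 + C) * (K `^ t) ^+ 2 * r `^ t * Zw 0 n t.
have c10 : 0 <= c1 by rewrite !mulr_ge0 ?addr_ge0 ?exprn_ge0 ?powR_ge0 ?Zw_ge0.
apply: (@le_trans _ _ (c1 * \sum_(i < n) \sum_(u <- words N 0 i | parent u) g i)).
  rewrite mulr_sumr; apply: ler_sum => i _; rewrite mulr_sumr.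
  rewrite big_mkcond [leRHS]big_mkcond big_seq [leRHS]big_seq; apply: ler_sum => u uw.
  have := uw; rewrite mem_words => /andP[vu /eqP su].
  case: ifP => bu; last by case: ifP => // _; rewrite mulr_ge0 ?g_ge0.
  have [Pu|nPu] := boolP (parent u); last first.
    rewrite big_seq_cond big1 // => a /andP[aI /andP[sa _]].
    by move: nPu; rewrite /parent bu su => /hasPn/(_ a aI); rewrite sa.
  apply: le_trans (parent_mass_le td (ltn_ord i) (cm_gt0 i) (@cm_le i) uw) _.
  rewrite ler_wpM2l // lef_pV2 ?posrE ?Zt_ge //.
  - by rewrite -su parent_level.
  - by rewrite !mulr_gt0 ?Zw_gt0 ?powR_gt0 // ltr0n.
  - by rewrite mulr_gt0 // ltr_wpDr ?lnRk_ge0.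
have -> : (1 + C) * (K `^ t) ^+ 2 * (C * ((2 + (ln K + 1) / - ln eta) / c0)) * r `^ t * Zw 0 n t
  = c1 * (C * bchain) by rewrite /c1 /bchain; ring.
by rewrite ler_wpM2l // sum_parents_le.
Qed.

End Ball.
End WordMass.

(** * Covers of Hausdorff null sets *)

Section HausdorffCovers.
Variables (R : realType) (d : nat).
Local Notation V := 'rV[R]_d.

(** The lower limit is the supremum of the tail infima, so one of these is positive; it lies below a
    term of the sequence, hence is a real number. *)
Lemma limn_einf_gt0 (u : nat -> R) : (0 < limn_einf (fun n => (u n)%:E))%E ->
  exists2 c : R, 0 < c & exists n0, forall n, (n0 <= n)%N -> c <= u n.
Proof.
set v := fun n => (u n)%:E; rewrite limn_einf_lim.
have -> : limn (einfs v) = ereal_sup (range (einfs v)).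
  by apply/cvg_lim => //; exact: cvg_einfs_sup.
move=> /ereal_sup_gt[_ [n0 _ <-]] e0.
have le_u n : (n0 <= n)%N -> (einfs v n0 <= (u n)%:E)%E.
  by move=> nn; apply: ereal_inf_lbound; exists n.
have efin : einfs v n0 \is a fin_num.
  rewrite fin_numE; apply/andP; split; first by rewrite gt_eqF // (lt_trans _ e0) // ltNy0.
  by rewrite lt_eqF // (le_lt_trans (le_u n0 (leqnn _))) // ltry.
exists (fine (einfs v n0)).
  by rewrite -lte_fin fineK.
by exists n0 => n nn; rewrite -lee_fin fineK // le_u.
Qed.

Lemma diam_pow_ge0 s (U : set V) : (0 <= diam_pow s U)%E.
Proof. by rewrite /diam_pow; case: ifP => // _; rewrite lee_fin powR_ge0. Qed.

Lemma hausdorff_null_cover s (A : set V) (eps delta : R) :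
  hausdorff_measure s A = 0%E -> 0 < eps -> 0 < delta ->
  exists U : nat -> set V, [/\ A `<=` \bigcup_i U i,
    forall i, (ediam (U i) <= delta%:E)%E &
    forall m, (\sum_(0 <= i < m) diam_pow s (U i) <= eps%:E)%E].
Proof.
move=> A0 eps0 delta0.
have : (hausdorff_delta s delta A < eps%:E)%E.
  apply: le_lt_trans (_ : (0 < eps%:E)%E); last by rewrite lte_fin.
  by rewrite -A0; apply: ereal_sup_ubound; exists delta.
move=> /ereal_inf_lt[_ [U [AU dU] <-]] h; exists U; split=> // m.
apply: le_trans (ltW h); apply: nneseries_lim_ge => i _ _.
exact: diam_pow_ge0.
Qed.

Lemma ediam_bound (U : set V) (delta : R) : (ediam U <= delta%:E)%E ->
  [/\ 0 <= fine (ediam U), (U !=set0 -> fine (ediam U) <= delta), (U = set0 -> fine (ediam U) = 0) &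
   forall x y, U x -> U y -> eucl_norm (x - y) <= fine (ediam U)].
Proof.
move=> Ud; have mem x y : U x -> U y -> ((eucl_norm (x - y))%:E <= ediam U)%E.
  by move=> Ux Uy; apply: ereal_sup_ubound; exists (x, y).
(* The empty set has [ediam] equal to [-oo], which [fine] sends to 0. *)
have [U0|/set0P[x Ux]] := eqVneq U set0.
  have dE : ediam U = -oo%E.
    rewrite /ediam U0 (_ : [set _ | _ in _] = set0) ?ereal_sup0 //.
    by apply/seteqP; split=> // _ [p [] //].
  by rewrite dE; split=> //; rewrite U0 => // -[].
have d0 : (0 <= ediam U)%E.
  by have := mem x x Ux Ux; rewrite subrr eucl_norm0.
have dfin : ediam U \is a fin_num.
  by rewrite ge0_fin_numE // (le_lt_trans Ud) // ltry.
split.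
- by rewrite fine_ge0.
- by move=> _; rewrite -lee_fin fineK.
- by move=> U0; rewrite U0 in Ux.
- by move=> y z Uy Uz; rewrite -lee_fin fineK // mem.
Qed.

Lemma powR_addr_le (a b t : R) : 0 <= a -> 0 <= b -> 0 <= t ->
  (a + b) `^ t <= 2 `^ t * (a `^ t + b `^ t).
Proof.
move=> a0 b0 t0; wlog ab : a b a0 b0 / a <= b.
  move=> H; have [ab|/ltW ba] := leP a b; first exact: H.
  by rewrite addrC [X in _ * X]addrC; exact: H.
apply: (@le_trans _ _ ((2 * b) `^ t)).
  by apply: ge0_ler_powR; rewrite ?nnegrE ?addr_ge0 ?mulr_ge0 //; lra.
by rewrite powRM // ler_wpM2l ?powR_ge0 // lerDr powR_ge0.
Qed.

Lemma sum_half_powers (m : nat) : \sum_(i < m) (2 ^- i.+1 : R) <= 1.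
Proof.
have -> : \sum_(i < m) (2 ^- i.+1 : R) = 1 - 2 ^- m.
  elim: m => [|m IH]; first by rewrite big_ord0 expr0 invr1 subrr.
  rewrite big_ord_recr /= IH exprS; field; by rewrite expf_neq0.
by rewrite lerBlDr lerDl invr_ge0 exprn_ge0.
Qed.

(* The balls are open because the [i]-th diameter is enlarged by some [e] with
   [e^t <= eps' / 2^(i+1)]. *)
Lemma hausdorff_null_balls s t (A : set V) (eps delta : R) :
  hausdorff_measure s A = 0%E -> 0 <= s < t -> 0 < eps -> 0 < delta ->
  exists x : nat -> V, exists r : nat -> R,
    [/\ A `<=` \bigcup_i [set y | eucl_norm (y - x i) < r i],
        forall i, 0 < r i < delta &
        forall m, \sum_(i < m) r i `^ t <= eps].
Proof.
move=> A0 /andP[s0 st] eps0 delta0.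
have t0 : 0 < t by exact: le_lt_trans st.
have t2 : 0 < 2 `^ t :> R by rewrite powR_gt0.
(* With the factor [2 ^ t] lost in [powR_addr_le], one share [e0] pays for the diameters and one for
   the enlargements. *)
pose e0 := eps / (2 * 2 `^ t).
have e00 : 0 < e0 by rewrite divr_gt0 // mulr_gt0.
pose del := Num.min 1 (delta / 2).
have del0 : 0 < del by rewrite lt_min ltr01 divr_gt0.
have [U [AU dU sU]] := hausdorff_null_cover A0 e00 del0.
pose D i := fine (ediam (U i)).
pose e i : R := Num.min ((e0 * 2 ^- i.+1) `^ t^-1) (delta / 4).
have h0 i : 0 < e0 * 2 ^- i.+1 by rewrite mulr_gt0 // invr_gt0 exprn_gt0.
have ei0 i : 0 < e i by rewrite lt_min powR_gt0 // divr_gt0.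
have eit i : e i `^ t <= e0 * 2 ^- i.+1.
  have -> : e0 * 2 ^- i.+1 = ((e0 * 2 ^- i.+1) `^ t^-1) `^ t.
    by rewrite -powRrM mulVf ?gt_eqF // powRr1 // ltW.
  by apply: ge0_ler_powR; rewrite ?nnegrE ?powR_ge0 ?(ltW t0) ?(ltW (ei0 i)) // ge_min lexx.
have D0 i : 0 <= D i by have [] := ediam_bound (dU i).
have Ddel i : D i <= del.
  have [_ Hn He _] := ediam_bound (dU i).
  have [/He|/set0P/Hn//] := eqVneq (U i) set0.
  by rewrite /D => ->; exact: ltW.
(* Diameters are at most 1 by the choice of [del], so raising the exponent from [s] to [t] decreases
   the terms. Since [t > 0], a zero diameter contributes 0 even when [s = 0]. *)
have Dp i : ((D i `^ t)%:E <= diam_pow s (U i))%E.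
  have [_ _ He _] := ediam_bound (dU i); rewrite /diam_pow; case: ifPn => [/eqP/He|_].
    by rewrite /D => ->; rewrite powR0 // gt_eqF.
  rewrite lee_fin -/(D i); have [->|Dn0] := eqVneq (D i) 0.
    by rewrite powR0 ?powR_ge0 // gt_eqF.
  have Dgt : 0 < D i by rewrite lt_def Dn0 D0.
  have -> : t = s + (t - s) by rewrite addrC subrK.
  rewrite powRD ?Dn0 ?implybT // ler_piMr ?powR_ge0 //.
  have <- : 1 `^ (t - s) = 1 :> R by rewrite powR1.
  apply: ge0_ler_powR; rewrite ?nnegrE ?subr_ge0 ?(ltW st) //.
  by apply: le_trans (Ddel i) _; rewrite ge_min lexx.
have /choice[x Hx] : forall i, exists x : V, U i !=set0 -> U i x.
  by move=> i; have [[x Ux]|nU] := pselect (U i !=set0); [exists x|exists 0].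
exists x, (fun i => D i + e i); split.
- move=> y /AU[i _ Uy]; exists i => //=.
  have [_ _ _ H] := ediam_bound (dU i).
  have Ux : U i (x i) by apply: Hx; exists y.
  by apply: le_lt_trans (H _ _ Uy Ux) _; rewrite ltrDl.
- move=> i; rewrite ltr_wpDl //=.
  have h1 : D i <= delta / 2 by apply: le_trans (Ddel i) _; rewrite ge_min lexx orbT.
  have h2 : e i <= delta / 4 by rewrite ge_min lexx orbT.
  lra.
- move=> m.
  apply: (@le_trans _ _ (\sum_(i < m) 2 `^ t * (D i `^ t + e0 * 2 ^- i.+1))).
    apply: ler_sum => i _; apply: le_trans (powR_addr_le (D0 i) (ltW (ei0 i)) (ltW t0)) _.
    by rewrite ler_wpM2l ?(ltW t2) // lerD2l.
  rewrite -mulr_sumr big_split /= -mulr_sumr.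
  have h1 : \sum_(i < m) D i `^ t <= e0.
    rewrite -lee_fin; apply: le_trans (sU m); rewrite -sumEFin big_mkord.
    by apply: lee_sum => i _; exact: Dp.
  have h2 : e0 * \sum_(i < m) 2 ^- i.+1 <= e0.
    by rewrite ler_piMr ?(ltW e00) // sum_half_powers.
  have -> : eps = 2 `^ t * (e0 + e0) by rewrite /e0; field; rewrite gt_eqF.
  by rewrite ler_wpM2l ?(ltW t2) // lerD.
Qed.

End HausdorffCovers.

(** * Compositions of the generators *)

Section Compositions.
Variables (R : realType) (d : nat).
Local Notation V := 'rV[R]_d.
Variables (N : nat -> nat) (phi : forall j : nat, 'I_(N j) -> V -> V).

(* Levels are shifted by one: level [k] of [alph], [gen], [ev] is [I^(k+1)]. *)
Definition alph (k : nat) := N k.+1.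

(** Total in the letter: an index outside the alphabet gives the identity, a value kept out by
    restricting to [valid] words. *)
Definition gen (k i : nat) : V -> V :=
  if insub i is Some a then @phi k.+1 a else id.

Fixpoint ev (k : nat) (w : seq nat) : V -> V :=
  if w is a :: w' then gen k a \o ev k.+1 w' else id.

Lemma genE k (a : 'I_(N k.+1)) : gen k a = phi a.
Proof. by rewrite /gen valK. Qed.

Lemma gen_ord k i (h : (i < alph k)%N) : gen k i = @phi k.+1 (Ordinal h).
Proof. by rewrite -genE. Qed.

Lemma ev_cat k u v : ev k (u ++ v) = ev k u \o ev (k + size u) v.
Proof.
elim: u k => [|a u IH] k /=; first by rewrite addn0.
by rewrite IH addSnnS.
Qed.

Lemma valid_nthP k v :
  reflect (forall i, (i < size v)%N -> (nth 0%N v i < alph (k + i))%N) (valid alph k v).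
Proof.
elim: v k => [|a v IH] k /=; first by left.
apply: (iffP andP) => [[aN /IH H] [|i] iv|H] /=.
- by rewrite addn0.
- by rewrite -addSnnS; exact: H.
- split; first by have := H 0%N isT; rewrite addn0.
  by apply/IH => i iv; rewrite addSnnS; exact: (H i.+1).
Qed.

Local Notation word k m := {dffun forall j : 'I_m, 'I_(N (k.+1 + j))}.

Definition wseq k m (w : word k m) : seq nat := [seq val (w j) | j <- enum 'I_m].

Lemma compwE k m (w : word k m) : @compw R d N phi k.+1 m w = ev k (wseq w).
Proof.
(* Generalised from the full enumeration to runs of consecutive positions, so that the induction can
   advance the level. *)
have H (js : seq 'I_m) i : map val js = iota i (size js) ->
    foldr (fun (j : 'I_m) f => @phi (k.+1 + j) (w j) \o f) id js =
    ev (k + i) [seq val (w j) | j <- js].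
  elim: js i => [|j js IH] i //= [ji jsE].
  by rewrite (IH _ jsE) -ji -addnS -genE.
rewrite /compw (H _ 0%N) ?addn0 //.
by rewrite val_enum_ord size_enum_ord.
Qed.

Lemma size_wseq k m (w : word k m) : size (wseq w) = m.
Proof. by rewrite size_map size_enum_ord. Qed.

Lemma nth_wseq k m (w : word k m) (j : 'I_m) : nth 0%N (wseq w) j = w j.
Proof.
by rewrite (nth_map j) ?size_enum_ord // nth_ord_enum.
Qed.

Lemma valid_wseq k m (w : word k m) : valid alph k (wseq w).
Proof.
apply/valid_nthP => i; rewrite size_wseq => im.
by have := nth_wseq w (Ordinal im) => /= ->; exact: ltn_ord.
Qed.

Lemma wseq_inj k m : injective (@wseq k m).
Proof.
move=> w1 w2 E; apply/ffunP => j; apply: val_inj.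
by rewrite /= -!nth_wseq E.
Qed.

Lemma wseq_surj k v : valid alph k v -> exists w : word k (size v), wseq w = v.
Proof.
move=> /valid_nthP H.
have H' (j : 'I_(size v)) : (nth 0%N v j < N (k.+1 + j))%N by exact: H.
exists (finfun (fun j => Ordinal (H' j)) : word k (size v)).
apply: (@eq_from_nth _ 0%N); rewrite size_wseq // => i iv.
by have := nth_wseq (finfun (fun j => Ordinal (H' j)) : word k (size v)) (Ordinal iv) => /= ->; rewrite ffunE.
Qed.

Lemma sum_wseq k m (F : (V -> V) -> R) :
  \sum_(w : word k m) F (@compw R d N phi k.+1 m w) =
  \sum_(v <- words alph k m) F (ev k v).
Proof.
rewrite (eq_bigr (fun w => F (ev k (wseq w)))); last by move=> w _; rewrite compwE.
rewrite -(big_map (@wseq k m) predT (fun v => F (ev k v))).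
apply: perm_big; apply: uniq_perm.
- by rewrite map_inj_uniq ?index_enum_uniq //; exact: wseq_inj.
- exact: uniq_words.
move=> v; rewrite mem_words; apply/mapP/andP => [[w _ ->]|[vv /eqP sv]].
  by rewrite valid_wseq size_wseq eqxx.
by subst m; have [w E] := wseq_surj vv; exists w; rewrite ?mem_index_enum ?E.
Qed.

Lemma limit_setE (X : set V) : limit_set phi X =
  \bigcap_n \bigcup_(w in [set w | w \in words alph 0 n]) (ev 0 w @` X).
Proof.
apply: eq_bigcapr => n _; apply/seteqP; split=> [y [w _]|y [v]] /=.
  rewrite /phiw (@compwE 0 n w) => h; exists (@wseq 0 n w) => //=.
  by rewrite mem_words valid_wseq size_wseq eqxx.
rewrite mem_words => /andP[vv /eqP sv] h; subst n.
have [w E] := wseq_surj vv; exists w => //.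
by rewrite /phiw (@compwE 0 _ w) E.
Qed.

End Compositions.

(** * Sizes, distortion and packing for a fixed system *)

Section NCIFSFacts.
Variables (R : realType) (d : nat).
Local Notation V := 'rV[R]_d.
Variables (N : nat -> nat) (phi : forall j : nat, 'I_(N j) -> V -> V) (X U : set V) (K eta : R).
Hypotheses (d0 : (0 < d)%N) (gX : good_domain X) (X0 : X !=set0).
Hypothesis osc : forall j (a b : 'I_(N j)), (0 < j)%N -> a != b ->
  phi a @` interior X `&` phi b @` interior X = set0.
Hypothesis phiX : forall j (a : 'I_(N j)), (0 < j)%N -> phi a @` X `<=` X.
Hypotheses (oU : open U) (XU : X `<=` U).
Hypothesis phi_conf : forall j (a : 'I_(N j)), (0 < j)%N -> conformal_diffeo_into U (phi a).
Hypothesis K1 : 1 <= K.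
Hypothesis distortion : forall k m (w : {dffun forall j : 'I_m, 'I_(N (k + j))}) x y,
  (0 < k)%N -> (0 < m)%N -> U x -> U y ->
  scalef (compw phi w) x <= K * scalef (compw phi w) y.
Hypothesis phi_eta : forall j (a : 'I_(N j)), (0 < j)%N -> normD X (phi a) <= eta.

Local Notation ev := (ev phi).
Local Notation valid := (valid (alph N)).

Definition size_of (k : nat) (w : seq nat) : R := normD X (ev k w).
Local Notation S := size_of.

Let K0 : 0 < K := lt_le_trans ltr01 K1.

Lemma ev_U k w x : valid k w -> U x -> U (ev k w x).
Proof.
elim: w k => [|a w IH] k //= /andP[aN vw] Ux.
rewrite (gen_ord phi aN); have [_ _ _ H _] := phi_conf (Ordinal aN) (ltn0Sn _).
exact/H/IH.
Qed.

Lemma ev_X k w x : valid k w -> X x -> X (ev k w x).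
Proof.
elim: w k => [|a w IH] k //= /andP[aN vw] Xx.
rewrite (gen_ord phi aN); apply: (phiX (ltn0Sn _)).
by exists (ev k.+1 w x) => //; exact: IH.
Qed.

Lemma ev_conformal k w x : valid k w -> U x -> conformal_at (ev k w) x.
Proof.
elim: w k => [|a w IH] k /=; first by move=> _ _; exact: conformal_at_id.
move=> /andP[aN vw] Ux.
have [df _ _ _ cf] := phi_conf (Ordinal aN) (ltn0Sn _).
have cg : conformal_at (gen phi k a) (ev k.+1 w x).
  by rewrite (gen_ord phi aN); split; [exact/df/ev_U|exact/cf/ev_U].
by have [] := conformal_at_comp d0 (IH _ vw Ux) cg.
Qed.

Lemma scalef_ev_gt0 k w x : valid k w -> U x -> 0 < scalef (ev k w) x.
Proof. by move=> vw Ux; apply: scalef_gt0 => //; exact: ev_conformal. Qed.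

Lemma scalef_ev_cat k u v x : valid k (u ++ v) -> U x ->
  scalef (ev k (u ++ v)) x =
  scalef (ev k u) (ev (k + size u) v x) * scalef (ev (k + size u) v) x.
Proof.
rewrite valid_cat => /andP[vu vv] Ux; rewrite ev_cat.
have cu : conformal_at (ev k u) (ev (k + size u) v x).
  by apply: ev_conformal => //; exact: ev_U.
by have [] := conformal_at_comp d0 (ev_conformal vv Ux) cu.
Qed.

Lemma scalef_ev_distortion k w x y : valid k w -> U x -> U y ->
  scalef (ev k w) x <= K * scalef (ev k w) y.
Proof.
(* The distortion hypothesis concerns nonempty words; the empty word has scaling factor 1 and only
   needs [1 <= K]. *)
move=> vw Ux Uy; have [w0|w0] := posnP (size w).
  by move/size0nil: w0 => -> /=; rewrite !scalef_id // mulr1.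
have [w' <-] := wseq_surj vw; rewrite -compwE.
exact: distortion.
Qed.

Lemma size_of_has_sup k w : valid k w -> has_sup [set scalef (ev k w) x | x in X].
Proof.
move=> vw; have [x0 Xx0] := X0; split; first by exists (scalef (ev k w) x0); exists x0.
exists (K * scalef (ev k w) x0) => _ [x Xx <-].
by apply: scalef_ev_distortion => //; exact: XU.
Qed.

Lemma scalef_le_size k w x : valid k w -> X x -> scalef (ev k w) x <= S k w.
Proof.
move=> vw Xx; apply: ub_le_sup; last by exists x.
by case: (size_of_has_sup vw).
Qed.

Lemma size_of_le k w c : valid k w -> (forall x, X x -> scalef (ev k w) x <= c) -> S k w <= c.
Proof.
move=> vw H; apply: ge_sup; first by case: (size_of_has_sup vw).
by move=> _ [x Xx <-]; exact: H.
Qed.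

Lemma size_le_scalef k w x : valid k w -> U x -> S k w <= K * scalef (ev k w) x.
Proof.
move=> vw Ux; apply: size_of_le => // y Xy.
by apply: scalef_ev_distortion => //; exact: XU.
Qed.

Lemma scalef_le_Ksize k w x : valid k w -> U x -> scalef (ev k w) x <= K * S k w.
Proof.
move=> vw Ux; have [x0 Xx0] := X0.
apply: le_trans (scalef_ev_distortion vw Ux (XU Xx0)) _.
by rewrite ler_pM2l // scalef_le_size.
Qed.

Lemma size_of_gt0 k w : valid k w -> 0 < S k w.
Proof.
move=> vw; have [x0 Xx0] := X0; apply: lt_le_trans (scalef_le_size vw Xx0).
by apply: scalef_ev_gt0 => //; exact: XU.
Qed.

Lemma size_of_nil k : S k [::] = 1.
Proof.
rewrite /size_of /normD /= (_ : [set _ | _ in X] = [set 1]) ?sup1 //.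
have [x0 Xx0] := X0; apply/seteqP; split=> [_ [x _ <-]|_ ->] /=; first by rewrite scalef_id.
by exists x0 => //; rewrite scalef_id.
Qed.

Lemma size_of_submul k u v : valid k (u ++ v) ->
  S k (u ++ v) <= S k u * S (k + size u) v.
Proof.
move=> vuv; have := vuv; rewrite valid_cat => /andP[vu vv].
apply: size_of_le => // x Xx; rewrite scalef_ev_cat //; last exact: XU.
have XUx := XU Xx; have Xv := ev_X vv Xx.
by apply: ler_pM; rewrite ?scalef_le_size // ltW // scalef_ev_gt0 //; exact: ev_U.
Qed.

(** The suprema for [u] and [v] are attained at unrelated points; distortion moves the one for [u]
    to the image point [ev (k + size u) v x] at the cost of one factor [K]. *)
Lemma size_of_supmul k u v : valid k (u ++ v) ->
  S k u * S (k + size u) v <= K * S k (u ++ v).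
Proof.
move=> vuv; have := vuv; rewrite valid_cat => /andP[vu vv].
have Su := size_of_gt0 vu.
rewrite mulrC -(ler_pdivlMr _ _ Su); apply: (size_of_le vv) => x Xx.
have Ux := XU Xx; have sv0 := ltW (scalef_ev_gt0 vv Ux).
rewrite (ler_pdivlMr _ _ Su); apply: (@le_trans _ _ (K * scalef (ev k (u ++ v)) x)).
  rewrite (scalef_ev_cat vuv Ux) mulrA [leLHS]mulrC.
  by apply: (ler_wpM2r sv0); apply: (size_le_scalef vu); exact: ev_U.
by apply: (ler_wpM2l (ltW K0)); exact: scalef_le_size.
Qed.

Lemma size_of1 k a (h : (a < alph N k)%N) : S k [:: a] = normD X (@phi k.+1 (Ordinal h)).
Proof. by rewrite /size_of /= (gen_ord phi h). Qed.

Lemma size_of_eta k a : (a < alph N k)%N -> S k [:: a] <= eta.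
Proof. by move=> h; rewrite (size_of1 h); exact: phi_eta. Qed.

(** Distortion bounds the scaling factor below by [S k w / K] on the whole ball, so the open mapping
    lemma yields an image ball of comparable size. *)
Lemma ev_ball k w z q (s : R) : valid k w -> 0 < s ->
  (forall x, eucl_norm (x - z) <= s -> X x) ->
  eucl_norm (q - ev k w z) < S k w / K * s ->
  exists2 x, eucl_norm (x - z) < s & ev k w x = q.
Proof.
move=> vw s0 Hs; apply: conformal_open_mapping => // x /Hs/XU Ux.
by split; [exact: ev_conformal|rewrite ler_pdivrMr // mulrC size_le_scalef].
Qed.

Lemma ev_interior k w x : valid k w -> interior X x -> interior X (ev k w x).
Proof.
move=> vw /nbhs_ballP[e /= e0 He].
have e20 : 0 < e / 2 by rewrite divr_gt0.
have He' y : eucl_norm (y - x) <= e / 2 -> X y.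
  move=> yx; apply: He; rewrite -ball_normE /= distrC.
  by apply: le_lt_trans (normr_le_eucl _) _; apply: le_lt_trans yx _; rewrite gtr_pMr // invf_lt1 // ltr1n.
have c0 : 0 < S k w / K * (e / 2) by rewrite !mulr_gt0 ?invr_gt0 ?size_of_gt0.
have dR0 : 0 < d%:R :> R by rewrite ltr0n.
apply/nbhs_ballP; exists (S k w / K * (e / 2) / d%:R) => /=; first by rewrite divr_gt0.
move=> q; rewrite -ball_normE /= distrC ltr_pdivlMr // mulrC => qx.
have [|y yx <-] := @ev_ball k w x q (e / 2) vw e20 He'.
  by apply: le_lt_trans qx; exact: eucl_le_normr.
by apply: ev_X => //; apply: He'; exact: ltW.
Qed.

(** A common first letter is cancelled by injectivity on [U]. At the first difference the open set
    condition applies, because the remaining maps send interior points to interior points. *)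
Lemma ev_disjoint k u v x y : valid k u -> valid k v -> ~~ prefix u v -> ~~ prefix v u ->
  interior X x -> interior X y -> ev k u x = ev k v y -> False.
Proof.
have IU z : interior X z -> U z by move=> /interior_subset/XU.
elim: u v k => [|a u IH] [|b v] k //=.
move=> /andP[aN vu] /andP[bN vv]; have [ab|ab] := eqVneq a b.
  subst b; move=> puv pvu ix iy.
  rewrite (gen_ord phi aN) => E.
  have [_ _ inj _ _] := phi_conf (Ordinal aN) (ltn0Sn _).
  by apply: (IH v k.+1) => //; apply: inj E; apply: ev_U => //; exact: IU.
move=> _ _ ix iy; rewrite (gen_ord phi aN) (gen_ord phi bN) => E.
have := @osc k.+1 (Ordinal aN) (Ordinal bN) (ltn0Sn _) ab.
move/seteqP => [+ _]; apply; split.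
  by exists (ev k.+1 u x) => //; exact: ev_interior.
by exists (ev k.+1 v y) => //; exact: ev_interior.
Qed.

Definition hits k (x0 : V) (r : R) (w : seq nat) : bool :=
  `[< exists2 y, X y & eucl_norm (ev k w y - x0) < r >].

Lemma hits_prefix k x0 r u v : valid k (u ++ v) -> hits k x0 r (u ++ v) -> hits k x0 r u.
Proof.
rewrite valid_cat => /andP[vu vv] /asboolP[y Xy]; rewrite ev_cat => H.
apply/asboolP.
by exists (ev (k + size u) v y) => //; exact: ev_X.
Qed.

(* [phi_w(X)] contains a cube of radius comparable to [min (S k w) r] at distance
   [O(r)] from [x0]; the cubes of an antichain are disjoint by the open set
   condition. *)
Lemma antichain_packing : exists2 C : R, 0 <= C & forall k x0 (r : R) (L : seq (seq nat)),
  0 < r -> uniq L -> antichain L -> {in L, forall w, valid k w && hits k x0 r w} ->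
  \sum_(w <- L) Num.min (S k w) r ^+ d <= C * r ^+ d.
Proof.
have [e e0 He] : exists2 e : R, 0 < e & forall x, X x -> inner_balls X e x.
  exact: good_domain_inner_balls.
have [cX _ _] := gX.
(* When [X] is not convex, the segment from a point of [X] to the centre of its inner ball may leave
   [X]; uniform room inside [U] keeps the mean value estimate applicable. *)
have [eU eU0 HeU] : exists2 eU : R, 0 < eU & forall x, X x -> ball x eU `<=` U.
  apply: compact_uniform_gt0 => //.
    move=> e1 e2 x /andP[_ e12] H y xy; apply: H; exact: le_ball xy.
  move=> x Xx; have /nbhs_ballP[s /= s0 Hs] : nbhs x U by apply: open_nbhs_nbhs; split => //; exact: XU.
  exists (s / 2); first by rewrite divr_gt0.
  move=> y _ yx z yz; apply: Hs; move: yz; rewrite -!ball_normE /= => yz.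
  rewrite -(subrK y x) -addrA; apply: le_lt_trans (ler_normD _ _) _.
  by rewrite [ltRHS](splitr s) ltrD // distrC.
pose e1 := Num.min e (eU / 2).
have e10 : 0 < e1 by rewrite lt_min e0 divr_gt0.
have dR0 : 0 < d%:R :> R by rewrite ltr0n.
(* An inner ball at scale [e1 * (m w / S k w)], halved, is mapped by [ev_ball] onto a set containing
   a Euclidean ball of radius [e * e1 / 2 / K * m w]; the last division passes to the max-norm. *)
pose kap := e * e1 / 2 / K / d%:R.
have kap0 : 0 < kap by rewrite /kap; do !apply: divr_gt0 => //; rewrite mulr_gt0.
pose A := K * (d%:R * e1) + 1 + kap.
have A0 : 0 < A.
  have := mulr_ge0 (ltW K0) (mulr_ge0 (ltW dR0) (ltW e10)).
  by move: kap0; rewrite /A; lra.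
exists ((8 * A / kap) ^+ d); first by apply: exprn_ge0; apply: divr_ge0; [apply: mulr_ge0 => //|]; exact: ltW.
move=> k x0 r L r0 uL aL HL.
pose m w := Num.min (S k w) r.
have vL w : w \in L -> valid k w by move=> /HL/andP[].
have m0 w : w \in L -> 0 < m w by move=> /vL vw; rewrite lt_min r0 size_of_gt0.
have key w : w \in L -> exists c : V, `|c - x0| + kap * m w <= A * r /\
    forall q, ball c (kap * m w) q -> exists2 x, interior X x & ev k w x = q.
  move=> wL; have vw := vL _ wL; have S0 := size_of_gt0 vw; have mw := m0 _ wL.
  have /andP[_ /asboolP[y Xy yx0]] := HL _ wL.
  (* The scale whose image under a map of size [S k w] is comparable to [m w]: for a big word only a
     part of the image of length about [r] near the hit is used. *)
  pose rho := e1 * (m w / S k w).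
  have mS : m w / S k w <= 1 by rewrite ler_pdivrMr // mul1r ge_min lexx.
  have rho0 : 0 < rho by rewrite !mulr_gt0 // invr_gt0.
  have rho_e1 : rho <= e1 by rewrite ler_piMr // ltW.
  have [|z [zy Hz]] := He y Xy rho.
    by rewrite rho0 (le_trans rho_e1) // ge_min lexx.
  have er0 : 0 < e * rho by rewrite mulr_gt0.
  have er2 : e * rho / 2 < e * rho by rewrite gtr_pMr // invf_lt1 // ltr1n.
  have er20 : 0 < e * rho / 2 by rewrite divr_gt0.
  have seg (s : R) : 0 <= s <= 1 -> U (y + s *: (z - y)).
    move=> /andP[s0 s1]; apply: (HeU y Xy); rewrite -ball_normE /= opprD addrA subrr sub0r normrN.
    rewrite normrZ ger0_norm //; apply: (@le_lt_trans _ _ (eU / 2)).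
      apply: le_trans (_ : `|z - y| <= _); first by rewrite ler_piMl.
      by apply: le_trans zy (le_trans rho_e1 _); rewrite ge_min lexx orbT.
    by rewrite gtr_pMr // invf_lt1 // ltr1n.
  have zm : eucl_norm (ev k w z - ev k w y) <= K * (d%:R * e1) * m w.
    have H (s : R) : 0 <= s <= 1 -> conformal_at (ev k w) (y + s *: (z - y)) /\
        scalef (ev k w) (y + s *: (z - y)) <= K * S k w.
      by move=> /seg Us; split; [exact: ev_conformal|exact: scalef_le_Ksize].
    apply: le_trans (conformal_mean_value d0 H) _.
    have -> : K * (d%:R * e1) * m w = K * S k w * (d%:R * rho).
      by rewrite /rho; field; rewrite gt_eqF.
    rewrite ler_wpM2l ?mulr_ge0 ?(ltW K0) ?(ltW S0) //.
    by apply: le_trans (eucl_le_normr _) _; rewrite ler_wpM2l.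
  exists (ev k w z); split.
    have mr : m w <= r by rewrite ge_min lexx orbT.
    have h1 : `|ev k w z - x0| <= K * (d%:R * e1) * r + r.
      apply: le_trans (normr_le_eucl _) _; apply: le_trans (ler_eucl_distD (ev k w y) _ _) _.
      rewrite lerD ?(ltW yx0) //; apply: le_trans zm _.
      by rewrite ler_wpM2l // (mulr_ge0 (ltW K0)) // (mulr_ge0 (ltW dR0)) // ltW.
    have h2 : kap * m w <= kap * r by rewrite ler_pM2l.
    have -> : A * r = K * (d%:R * e1) * r + r + kap * r by rewrite /A; ring.
    exact: lerD.
  move=> q; rewrite -ball_normE /= distrC => qz.
  have Hs x : eucl_norm (x - z) <= e * rho / 2 -> X x.
    move=> xz; apply: Hz; apply: le_lt_trans er2; apply: le_trans xz; exact: normr_le_eucl.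
  have [|x xz <-] := @ev_ball k w z q (e * rho / 2) vw er20 Hs.
    apply: le_lt_trans (eucl_le_normr _) _.
    have -> : S k w / K * (e * rho / 2) = d%:R * (kap * m w).
      by rewrite /kap /rho; field; rewrite !gt_eqF.
    by rewrite ltr_pM2l.
  exists x => //; apply/nbhs_ballP; exists (e * rho / 2 ) => //= x'.
  rewrite -ball_normE /= => xx'; apply: Hz.
  rewrite -(subrK x x') -addrA; apply: le_lt_trans (ler_normD _ _) _.
  rewrite [ltRHS](splitr (e * rho)); apply: ltrD; first by rewrite distrC.
  by apply: le_lt_trans xz; exact: normr_le_eucl.
have /choice[c Hc] : forall w, exists c : V, w \in L -> `|c - x0| + kap * m w <= A * r /\
    forall q, ball c (kap * m w) q -> exists2 x, interior X x & ev k w x = q.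
  move=> w; have [wL|_] := boolP (w \in L); last by exists 0.
  by have [c Hc] := key w wL; exists c.
have : \sum_(w <- L) (kap * m w) ^+ d <= (8 * (A * r)) ^+ d.
  apply: (@cube_packing R d _ L c (fun w => kap * m w) x0 (A * r) uL).
  - by apply: mulr_ge0; exact: ltW.
  - by move=> w wL; rewrite mulr_gt0 // m0.
  - move=> u v uLL vLL uv; apply/seteqP; split=> // q [].
    move=> /(Hc u uLL).2[x ix <-] /(Hc v vLL).2[y iy E].
    apply: (@ev_disjoint k u v x y) => //; try exact: vL.
      by apply: contra uv => /(aL _ _ uLL vLL) ->.
    by apply: contra uv => /(aL _ _ vLL uLL) ->.
  - by move=> w /Hc[].
rewrite (eq_bigr (fun w => kap ^+ d * m w ^+ d)) => [|w _]; last by rewrite exprMn.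
have kd0 : 0 < kap ^+ d := exprn_gt0 _ kap0.
rewrite -mulr_sumr => h; rewrite -(ler_pM2l kd0); apply: le_trans h _.
have -> : 8 * (A * r) = kap * (8 * A / kap * r) by field; rewrite gt_eqF.
rewrite [leLHS]exprMn (ler_pM2l kd0) le_eqVlt; apply/orP; left; apply/eqP.
exact: exprMn.
Qed.

(** * The quantities of the theorem expressed through word sizes *)

Hypotheses (N0 : forall j, (0 < j)%N -> (0 < N j)%N) (eta1 : eta < 1).
Variable t : R.
Hypothesis t0 : 0 <= t.

Local Notation Z := (Zw (alph N) S).
Local Notation words := (words (alph N)).

Lemma alph_gt0 k : (0 < alph N k)%N.
Proof. exact: N0. Qed.

Lemma eta_gt0 : 0 < eta.
Proof.
apply: lt_le_trans (size_of_eta (alph_gt0 0)).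
by apply: size_of_gt0; rewrite /= alph_gt0.
Qed.

Lemma ZnE n : Zn phi X n t = Z 0 n t.
Proof.
case: n => [|n]; first by rewrite /Zw /= big_seq1 size_of_nil powR1.
exact: (@sum_wseq R d N phi 0 n.+1 (fun f => normD X f `^ t)).
Qed.

Lemma normD_size k (a : 'I_(N k.+1)) : normD X (phi a) = S k [:: val a].
Proof. by rewrite (size_of1 (ltn_ord a)); congr normD; congr (phi _); exact: val_inj. Qed.

Lemma cmin_bounds k : 0 < cmin phi X k.+1 /\
  forall a, (a < alph N k)%N -> cmin phi X k.+1 <= S k [:: a].
Proof.
have [|m m0 Hm] := @finite_lower_bound R _ (enum 'I_(N k.+1)) (fun a => normD X (phi a)).
  by move=> a _; rewrite normD_size; apply: size_of_gt0; rewrite /= ltn_ord.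
have lb : lbound [set normD X (phi a) | a in [set: 'I_(N k.+1)]] m.
  by move=> _ [a _ <-]; apply: Hm; rewrite mem_enum.
split=> [|a aN].
  apply: lt_le_trans m0 _; apply: lb_le_inf => //.
  by exists (normD X (phi (Ordinal (alph_gt0 k)))), (Ordinal (alph_gt0 k)).
rewrite (size_of1 aN); apply: ge_inf; first by exists m.
by exists (Ordinal aN).
Qed.

Lemma ratio_le_rho k a b : (a < alph N k)%N -> (b < alph N k)%N ->
  S k [:: a] / S k [:: b] <= rho phi X k.+1.
Proof.
move=> aN bN; have [c0 cle] := cmin_bounds k.
have S0 i : (i < alph N k)%N -> 0 < S k [:: i] by move=> iN; apply: size_of_gt0; rewrite /= iN.
rewrite (size_of1 aN) (size_of1 bN); apply: ub_le_sup; last by exists (Ordinal aN, Ordinal bN).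
exists (eta / cmin phi X k.+1) => _ [[i j] _ <-] /=; rewrite !normD_size.
apply: ler_pM; rewrite ?invr_ge0 ?size_of_eta ?ltn_ord //.
- by apply: ltW; apply: S0; exact: ltn_ord.
- by apply: ltW; apply: S0; exact: ltn_ord.
by rewrite lef_pV2 ?posrE ?cle ?S0 ?ltn_ord.
Qed.

Lemma rho_le_maxrho k : rho phi X k.+1 <= maxrho phi X k.+1.
Proof.
by rewrite /maxrho; apply: le_bigmax_seq => //; rewrite mem_index_iota ltnSn.
Qed.

Lemma maxrho_mono i j : (i <= j)%N -> maxrho phi X i.+1 <= maxrho phi X j.+1.
Proof. by move=> ij; apply: le_bigmax_nat. Qed.

Lemma maxrho_ge1 k : 1 <= maxrho phi X k.+1.
Proof.
apply: le_trans (rho_le_maxrho k); apply: le_trans (ratio_le_rho (alph_gt0 k) (alph_gt0 k)).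
rewrite mulfV // gt_eqF //; apply: size_of_gt0; by rewrite /= alph_gt0.
Qed.

Lemma size_ratio k a b : (a < alph N k)%N -> (b < alph N k)%N ->
  S k [:: a] <= maxrho phi X k.+1 * S k [:: b].
Proof.
move=> aN bN; have Sb : 0 < S k [:: b] by apply: size_of_gt0; rewrite /= bN.
rewrite -(ler_pdivrMr _ _ Sb); apply: le_trans (rho_le_maxrho k).
exact: ratio_le_rho.
Qed.

(** Packing in a ball that contains all of [X]: every word of length [n] hits it, and its radius is
    at least 1, so the minimum with [r] is the size itself. *)
Lemma Zd_bounded : exists2 B : R, 0 <= B & forall k n, Z k n d%:R <= B.
Proof.
have [C C0 HC] := antichain_packing.
have [cX _ _] := gX; have [x0 Xx0] := X0.
have [D D0 HD] := compact_dist_bound x0 cX.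
pose r := d%:R * D + 1.
have r1 : 1 <= r by rewrite /r lerDr mulr_ge0 // ltW.
exists (C * r ^+ d); first by rewrite mulr_ge0 // exprn_ge0 // (le_trans ler01).
move=> k n; have vw w : w \in words k n -> valid k w by rewrite mem_words => /andP[].
have := @HC k x0 r (words k n) (lt_le_trans ltr01 r1) (uniq_words _ _ _).
have -> : \sum_(w <- words k n) Num.min (S k w) r ^+ d = Z k n d%:R.
  rewrite /Zw big_seq [RHS]big_seq; apply: eq_bigr => w /vw v.
  have S1 := S_le1 eta_gt0 eta1 size_of_nil size_of_gt0 size_of_submul size_of_eta v.
  by rewrite min_l ?powR_mulrn ?(ltW (size_of_gt0 v)) // (le_trans S1).
apply; first by apply: (@antichain_same_size _ n) => w; rewrite mem_words => /andP[_ /eqP].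
move=> w /vw v; rewrite v /=; apply/asboolP; exists x0 => //.
apply: le_lt_trans (eucl_le_normr _) _; rewrite /r.
by rewrite ltr_pwDr // ler_wpM2l // HD //; exact: ev_X.
Qed.

(** * Consequences of the lower bound on [Ztilde] *)

Section Liminf.
Variables (c : R) (k0 : nat).
Hypothesis c_gt0 : 0 < c.
Hypothesis Ztilde_ge : forall n, (k0 <= n)%N ->
  c <= Ztilde phi X n.+1 t / (1 + ln (maxrho phi X n.+1)).

Lemma Ztilde_lower i : (k0 <= i)%N -> c * (1 + ln (maxrho phi X i.+1)) <=
  Z 0 i t * (alph N i)%:R `^ (t / d%:R) * cmin phi X i.+1 `^ t.
Proof.
move=> ki; rewrite -ler_pdivlMr; first by rewrite -ZnE; exact: Ztilde_ge.
by rewrite ltr_wpDr ?ln_ge0 ?maxrho_ge1.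
Qed.

(** If [t > d], uniform contraction gives Z_i(t) <= B q^i with [q = eta ^ (t - d) < 1]. The
    remaining factors equal (N c^d)^(t/d), bounded through the one-letter sum at exponent [d], so a
    fixed positive [c] cannot stay below [Ztilde]. *)
Lemma exponent_le_dim : t <= d%:R.
Proof.
have [B B0 HB] := Zd_bounded; rewrite leNgt; apply/negP => dt.
have dR0 : 0 < d%:R :> R by rewrite ltr0n.
have td0 : 0 < t - d%:R by rewrite subr_gt0.
have e0 := eta_gt0.
pose q := eta `^ (t - d%:R).
have q0 : 0 <= q by exact: powR_ge0.
have q1 : q < 1.
  have <- : 1 `^ (t - d%:R) = 1 :> R by rewrite powR1.
  by apply: gt0_ltr_powR; rewrite ?nnegrE // ltW.
have Zq i : Z 0 i t <= B * q ^+ i.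
  apply: (@le_trans _ _ (Z 0 i d%:R * q ^+ i)); last by rewrite ler_wpM2r // exprn_ge0.
  rewrite /Zw mulr_suml big_seq [leRHS]big_seq; apply: ler_sum => w.
  rewrite mem_words => /andP[vw /eqP sw]; have Sw := size_of_gt0 vw.
  have -> : t = d%:R + (t - d%:R) by rewrite addrC subrK.
  rewrite powRD; last by rewrite (gt_eqF Sw) implybT.
  rewrite ler_wpM2l ?powR_ge0 //.
  have -> : q ^+ i = (eta ^+ i) `^ (t - d%:R).
    by rewrite -[in RHS]powR_mulrn ?(ltW e0) // -powRrM mulrC powRrM powR_mulrn.
  have Sle : S 0 w <= eta ^+ i.
    by rewrite -sw; exact: (S_le_etaX size_of_nil size_of_gt0 size_of_submul size_of_eta vw).
  apply: ge0_ler_powR Sle; [exact: ltW|by rewrite nnegrE ltW|].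
  by rewrite nnegrE exprn_ge0 // ltW.
have Nc i : (alph N i)%:R `^ (t / d%:R) * cmin phi X i.+1 `^ t <= B `^ (t / d%:R).
  have [c0 cle] := cmin_bounds i.
  have -> : cmin phi X i.+1 `^ t = (cmin phi X i.+1 `^ d%:R) `^ (t / d%:R).
    by rewrite -powRrM mulrC divfK // gt_eqF.
  rewrite -powRM ?powR_ge0 //; apply: ge0_ler_powR; last 1 first.
  - apply: le_trans (HB i 1%N).
    exact: (Zw1_ge (ltW dR0) size_of_gt0 (ltW c0) cle).
  - by apply: divr_ge0 => //; exact: ltW.
  - by rewrite nnegrE; apply: mulr_ge0 => //; exact: powR_ge0.
  - by rewrite nnegrE.
pose B' := B * B `^ (t / d%:R) + 1.
have B'0 : 0 < B' by rewrite ltr_wpDl // mulr_ge0 // powR_ge0.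
have cq i : (k0 <= i)%N -> c <= B' * q ^+ i.
  move=> ki; apply: (@le_trans _ _ (c * (1 + ln (maxrho phi X i.+1)))).
    by rewrite ler_peMr ?(ltW c_gt0) // lerDl ln_ge0 ?maxrho_ge1.
  apply: le_trans (Ztilde_lower ki) _; rewrite -mulrA.
  apply: (@le_trans _ _ ((B * q ^+ i) * B `^ (t / d%:R))).
    apply: ler_pM; [exact: Zw_ge0| |exact: Zq|exact: Nc].
    by apply: mulr_ge0; exact: powR_ge0.
  by rewrite mulrAC (ler_wpM2r (exprn_ge0 _ q0)) // lerDl.
have : (GRing.exp q : R ^nat) @ \oo --> 0 by apply: cvg_expr; rewrite ger0_norm.
move=> /cvgrPdist_lt /(_ (c / B')); rewrite divr_gt0 // => /(_ isT) [m _ Hm].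
have /= := Hm (maxn m k0) (leq_maxl _ _).
rewrite sub0r normrN ger0_norm ?exprn_ge0 // ltr_pdivlMr // mulrC.
by rewrite ltNge cq // leq_maxr.
Qed.

Lemma ball_mass : exists2 M : R, 0 <= M & exists2 r0 : R, 0 < r0 &
  forall x0 (r : R) n, 0 < r < r0 -> (forall w, w \in words 0 n -> S 0 w <= r) ->
  \sum_(w <- words 0 n | hits 0 x0 r w) S 0 w `^ t <= M * r `^ t * Z 0 n t.
Proof.
have [C C0 HC] := antichain_packing.
(* [m] bounds from below the sizes of all words of length at most [k0]; radii below it postpone
   every cut to levels where the lower bound on [Ztilde] holds. *)
have [|m m0 Hm] := @finite_lower_bound R _
    (flatten [seq words 0 i | i <- iota 0 k0.+1]) (S 0).
  move=> w /flattenP[s /mapP[i _ ->]]; rewrite mem_words => /andP[vw _].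
  exact: size_of_gt0.
have E0 : 0 < - ln eta by rewrite oppr_gt0 ln_lt0 // eta_gt0.
exists ((1 + C) * (K `^ t) ^+ 2 * (C * ((2 + (ln K + 1) / - ln eta) / c))).
  have lnK0 : 0 <= ln K by exact: ln_ge0.
  apply: mulr_ge0; first by apply: mulr_ge0; [exact: addr_ge0|exact: exprn_ge0 (powR_ge0 _ _)].
  apply: mulr_ge0 => //; apply: divr_ge0; last exact: ltW.
  by apply: addr_ge0 => //; apply: divr_ge0; [exact: addr_ge0|exact: ltW].
exists (Num.min 1 m); first by rewrite lt_min ltr01.
move=> x0 r n; rewrite lt_min => /and3P[r0 r1 rm] Hn.
have hitp u v : valid 0 (u ++ v) -> hits 0 x0 r (u ++ v) -> hits 0 x0 r u.
  exact: hits_prefix.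
have pack L : uniq L -> antichain L -> {in L, forall w, valid 0 w && hits 0 x0 r w} ->
    \sum_(w <- L) Num.min (S 0 w) r ^+ d <= C * r ^+ d.
  by move=> uL aL HL; exact: (HC 0%N x0 r L).
have big_k0 w : valid 0 w -> (size w <= k0)%N -> r < S 0 w.
  move=> vw sw; apply: lt_le_trans rm _; apply: Hm.
  apply/flattenP; exists (words 0 (size w)); last by rewrite mem_words vw eqxx.
  by apply/mapP; exists (size w) => //; rewrite mem_iota.
exact: (hit_mass_le K1 eta_gt0 eta1 d0 t0 alph_gt0 size_of_nil size_of_gt0
  size_of_submul size_of_supmul size_of_eta hitp r0 r1 C0 pack Hn maxrho_ge1
  maxrho_mono size_ratio (fun i => (cmin_bounds i).1) (fun i => (cmin_bounds i).2)
  big_k0 c_gt0 Ztilde_lower exponent_le_dim).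
Qed.

(** Compactness is applied to [X], covered by the open sets formed of [B n] and the complement of
    the closed level set [E n]. A point of a cylinder of length at least [m] lies in every [E i]
    with [i < m], so the finite subcover must catch it by some [B i]. *)
Lemma finite_cover_words (B : nat -> set V) : (forall i, open (B i)) ->
  limit_set phi X `<=` \bigcup_i B i ->
  exists m, forall n w, (m <= n)%N -> w \in words 0 n ->
    exists2 i, (i < m)%N & exists2 y, X y & B i (ev 0 w y).
Proof.
move=> oB cov; have [cX _ _] := gX.
pose E n := \bigcup_(w in [set w | w \in words 0 n]) (ev 0 w @` X).
have clE n : closed (E n).
  apply: closed_bigcup; first exact: finite_seq.
  move=> w /=; rewrite mem_words => /andP[vw _].
  apply: compact_closed; first exact: norm_hausdorff.
  apply: continuous_compact => //; apply: continuous_in_subspaceT => x /set_mem Xx.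
  by apply: differentiable_continuous; have [] := ev_conformal vw (XU Xx).
have oG n : open (B n `|` ~` E n) by apply: openU => //; exact: closed_openC.
have XG : X `<=` \bigcup_(n in [set: nat]) (B n `|` ~` E n).
  move=> x Xx; have [/cov[i _ Bx]|] := pselect (limit_set phi X x).
    by exists i => //; left.
  rewrite limit_setE => /existsNP[n /not_implyP[_ nE]].
  by exists n => //; right.
move: cX; rewrite compact_cover => /(_ _ _ _ (fun n _ => oG n) XG) [F _ FX].
pose m := (\max_(i <- F) i).+1.
have Fm i : i \in F -> (i < m)%N by move=> iF; rewrite ltnS leq_bigmax_seq.
exists m => n w mn ww; have := ww; rewrite mem_words => /andP[vw /eqP sw].
have [y Xy] := X0.
have [i iF] := FX _ (ev_X vw Xy).
move=> [Bi|nE]; first by exists i; [exact: Fm|exists y].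
exfalso; apply: nE; exists (take i w) => /=.
  rewrite mem_words valid_take //= size_takel // sw.
  by apply: leq_trans mn; rewrite ltnW // Fm.
exists (ev (0 + size (take i w)) (drop i w) y).
  by apply: ev_X => //; move: vw; rewrite -{1}(cat_take_drop i w) valid_cat => /andP[].
by rewrite -[in RHS](cat_take_drop i w) ev_cat.
Qed.

Lemma words_small (r : R) : 0 < r -> exists n0, forall n, (n0 <= n)%N ->
  forall w, w \in words 0 n -> S 0 w <= r.
Proof.
move=> r0; have : (GRing.exp eta : R ^nat) @ \oo --> 0.
  by apply: cvg_expr; rewrite ger0_norm // ltW // eta_gt0.
move=> /cvgrPdist_lt /(_ _ r0) [n0 _ Hn]; exists n0 => n nn w.
rewrite mem_words => /andP[vw /eqP sw].
apply: le_trans (S_le_etaX size_of_nil size_of_gt0 size_of_submul size_of_eta vw) _.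
have /= := Hn n nn.
by rewrite sub0r normrN ger0_norm ?exprn_ge0 ?(ltW eta_gt0) // sw => /ltW.
Qed.

Lemma hausdorff_measure_limit_set_neq0 s : 0 <= s < t ->
  hausdorff_measure s (limit_set phi X) <> 0%E.
Proof.
move=> st H0; have [M M0 [r0 r00 HM]] := ball_mass.
(* Chosen so that [M] times the total of the [r i ^ t] stays below 1. *)
have eps0 : 0 < (2 * (M + 1))^-1 by rewrite invr_gt0 mulr_gt0 // ltr_wpDl.
have [x [r [cov rr sr]]] := hausdorff_null_balls H0 st eps0 r00.
pose B i := [set y : V | eucl_norm (y - x i) < r i].
have oB i : open (B i).
  have -> : B i = (fun y : V => eucl_norm (y - x i)) @^-1` [set z | z < r i] by [].
  apply: open_comp; last exact: open_lt.
  by move=> y _; exact: eucl_dist_continuous.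
have [m Hm] := finite_cover_words oB cov.
(* Only the first [m] balls matter, so one length [n] makes all words small with respect to each of
   their radii. *)
have [|rm rm0 Hrm] := @finite_lower_bound R _ (iota 0 m) r.
  by move=> i _; have /andP[] := rr i.
have [n0 Hn0] := words_small rm0.
pose n := maxn m n0.
have small i : (i < m)%N -> forall w, w \in words 0 n -> S 0 w <= r i.
  move=> im w ww; apply: (@le_trans _ _ rm); first by apply: Hn0 ww; exact: leq_maxr.
  by apply: Hrm; rewrite mem_iota.
have Z0 : 0 < Z 0 n t by exact: Zw_gt0 alph_gt0 size_of_gt0 _ _ _.
(* Every word of length [n] hits one of the [m] balls; the mass bound makes the right-hand side
   strictly smaller than [Z 0 n t]. *)
have : Z 0 n t <= \sum_(i < m) \sum_(w <- words 0 n | hits 0 (x i) (r i) w) S 0 w `^ t.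
  rewrite (eq_bigr (fun i : 'I_m => \sum_(w <- words 0 n)
    if hits 0 (x i) (r i) w then S 0 w `^ t else 0)); last first.
    by move=> i _; rewrite big_mkcond.
  rewrite exchange_big /= /Zw big_seq [leRHS]big_seq; apply: ler_sum => w ww.
  have [i im [y Xy Bi]] := Hm n w (leq_maxl _ _) ww.
  have hi : hits 0 (x i) (r i) w by apply/asboolP; exists y.
  rewrite (bigD1 (Ordinal im)) //= hi lerDl; apply: sumr_ge0 => j _.
  by case: ifP => // _; exact: powR_ge0.
apply/negP; rewrite -ltNge.
apply: (@le_lt_trans _ _ (\sum_(i < m) M * r i `^ t * Z 0 n t)).
  by apply: ler_sum => i _; apply: HM; [exact: rr|exact: small].
rewrite -mulr_suml -mulr_sumr -[ltRHS]mul1r ltr_pM2r //.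
apply: (@le_lt_trans _ _ (M * (2 * (M + 1))^-1)); first by rewrite ler_wpM2l // sr.
by rewrite ltr_pdivrMr ?mulr_gt0 ?ltr_wpDl // mul1r; lra.
Qed.

End Liminf.

End NCIFSFacts.

(** Excludes an empty [X]: there every supremum is the default value 0, so [cmin] vanishes and the
    lower limit could not be positive. *)
Lemma Ztilde_set0 (R : realType) (d : nat) (N : nat -> nat)
    (phi : forall j : nat, 'I_(N j) -> 'rV[R]_d -> 'rV[R]_d) n (t : R) :
  (0 < N n)%N -> 0 < t -> Ztilde phi set0 n t = 0.
Proof.
move=> Nn t0; rewrite /Ztilde.
suff -> : cmin phi set0 n = 0 by rewrite powR0 ?mulr0 // gt_eqF.
rewrite /cmin (_ : [set _ | _ in _] = [set 0]) ?inf1 //.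
have E (a : 'I_(N n)) : normD set0 (phi n a) = 0 by rewrite /normD image_set0 sup0.
apply/seteqP; split=> [_ [a _ <-]|_ ->] /=; first exact: E.
by exists (Ordinal Nn); rewrite ?E.
Qed.

Theorem theorem3p2 (R : realType) (d : nat) (X : set 'rV[R]_d)
  (N : nat -> nat) (phi : forall j : nat, 'I_(N j) -> 'rV[R]_d -> 'rV[R]_d)
  (t : R) :
  (0 < d)%N ->
  good_domain X ->
  is_finite_NCIFS phi X ->
  0 <= t ->
  (0 < limn_einf (fun n => (Ztilde phi X n t / (1 + ln (maxrho phi X n)))%:E))%E ->
  (t%:E <= hausdorff_dim (limit_set phi X))%E.
Proof.
move=> d0 gX [N0 osc phiX [U [[oU _ XU conf] [K K1 dist]]] [eta eta1 phi_eta]] t0.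
move=> /limn_einf_gt0[c c0 [k0 Hc]].
apply: le_ereal_inf_tmp => _ [s [s0 Hs] <-]; rewrite lee_fin leNgt; apply/negP => st.
(* At this point [0 <= s < t], so [t] is positive and the power of a vanishing [cmin] is indeed
   0. *)
have [XE|/set0P X0] := eqVneq X set0.
  have := Hc k0.+1 (leqnSn k0); rewrite XE Ztilde_set0 ?mul0r ?N0 ?(le_lt_trans s0 st) //.
  by rewrite leNgt c0.
apply: (@hausdorff_measure_limit_set_neq0 R d N phi X U K eta d0 gX X0 osc phiX oU XU
  conf K1 dist phi_eta N0 eta1 t t0 c k0 c0 _ s) => //.
(* Levels of words start at 0 and those of the system at 1, whence the shifted index. *)
- by move=> n kn; apply: Hc; exact: leqW.
- by rewrite s0 st.
Qed.
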